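(* Let $\psi:\mathbb S^1\to\mathbb R$ be a $C^3$ function such that $C'_\psi=\{\hat x:\psi'(\hat x)=0\}$ and $C''_\psi=\{\hat z:\psi''(\hat z)=0\}$ are finite, $\min_{\hat x\in C'_\psi}|\psi''(\hat x)|>0$ and $\min_{\hat z\in C''_\psi}|\psi'''(\hat z)|>0$. Fix an arbitrary $c_0>0$. Then given $\alpha,\beta\in(0,1)$, there is a constant $C=C_{\alpha,\beta}>0$ such that for all $L,a,\epsilon$ where - $L$ is sufficiently large (depending on $\psi,c_0,\alpha,\beta$), - $a\in[0,1)$ is chosen so that $f=f_{L,a}$ satisfies: for any $\hat x,\hat x'\in C'_\psi$, $f(\hat x)-\hat x'\ (\mathrm{mod}\ 1)\notin\mathcal N_{c_0}(C'_\psi)$, and - $\epsilon\ge L^{-CL^{2-\beta}}$, we have $\lambda_1^\epsilon\ge\alpha\log L$.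
   Context: $\mathbb S^1=\mathbb R/\mathbb Z$ and $\mathbb T^2=\mathbb S^1\times\mathbb S^1$. $\mathcal N_c(S)$ denotes the $c$-neighborhood of $S$ in $\mathbb S^1$. For $L>1$ and $a\in[0,1)$ let $f=f_{L,a}=L\psi+a:\mathbb S^1\to\mathbb R$, and let $F:\mathbb T^2\to\mathbb T^2$ be the area-preserving diffeomorphism $F(x,y)=(f(x)-y\ (\mathrm{mod}\ 1),\ x)$. For $\omega\in\mathbb R$ let $S_\omega(x,y)=(x+\omega\ (\mathrm{mod}\ 1),y)$ and $F_\omega=F\circ S_\omega$. For $\epsilon>0$ let $\nu^\epsilon$ be the uniform probability distribution on $[-\epsilon,\epsilon]$, $\Omega=[-\epsilon,\epsilon]^{\mathbb N}$, $\mathbb P=(\nu^\epsilon)^{\mathbb N}$; for $\underline\omega=(\omega_1,\omega_2,\dots)\in\Omega$ put $F^n_{\underline\omega}=F_{\omega_n}\circ\cdots\circ F_{\omega_1}$. The number $\lambda_1^\epsilon$ (depending on $\psi,L,a,\epsilon$) is the common value of $\lim_{n\to\infty}\frac1n\log\|(dF^n_{\underline\omega})_{(x,y)}\|$, which exists and is the same for every $(x,y)\in\mathbb T^2$ and $\mathbb P$-a.e. $\underline\omega$. *)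

(* Defs.v *)
From HB Require Import structures.
From mathcomp Require Import all_boot all_order all_algebra.
From mathcomp Require Import all_classical all_reals all_analysis.

Set Implicit Arguments.
Unset Strict Implicit.
Unset Printing Implicit Defensive.

Import Order.TTheory GRing.Theory Num.Theory.
Import numFieldNormedType.Exports.

Local Open Scope classical_set_scope.
Local Open Scope ring_scope.

(* The circle R/Z is handled through R: a function on the circle is a
   1-periodic function on R, a subset of the circle is the set of its
   representatives in [0, 1[, and [mod1 x] is the representative of x. *)
Definition mod1 (R : realType) (x : R) : R := x - (Num.floor x)%:~R.

Definition circle_nbhd (R : realType) (c : R) (S : set R) : set R :=
  [set x | exists2 s, S s & exists k : int, `|x - s + k%:~R| < c].

Definition is_C3 (R : realType) (psi : R -> R) : Prop :=
  (forall k x, (k < 3)%N -> derivable (derive1n k psi) x 1) /\ continuous (derive1n 3 psi).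

Definition crit1 (R : realType) (psi : R -> R) : set R :=
  [set x | 0 <= x < 1 /\ derive1 psi x = 0].

Definition crit2 (R : realType) (psi : R -> R) : set R :=
  [set z | 0 <= z < 1 /\ derive1n 2 psi z = 0].

(* The image of the empty set has infimum 0 here, but the critical sets of a
   periodic function are never empty (Rolle), so [inf] is the minimum. *)
Definition nondegenerate_crit (R : realType) (psi : R -> R) : Prop :=
  [/\ finite_set (crit1 psi), finite_set (crit2 psi),
      0 < inf [set `|derive1n 2 psi x| | x in crit1 psi] &
      0 < inf [set `|derive1n 3 psi z| | z in crit2 psi]].

Definition fLa (R : realType) (psi : R -> R) (L a : R) : R -> R :=
  fun x => L * psi x + a.

(* [torusF f], [torusS w] and [torusFn f omega n] are the canonical lifts to
   the plane of F, S_w and F^n_omega: reductions mod 1 are omitted.  The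
   differential of a torus map at a point, in the standard coordinates, is the
   differential of its lift at any representative of that point.
   [omega i] stands for omega_(i+1). *)
Definition torusF (R : realType) (f : R -> R) (z : R * R) : R * R :=
  (f z.1 - z.2, z.1).

Definition torusS (R : realType) (w : R) (z : R * R) : R * R :=
  (z.1 + w, z.2).

Fixpoint torusFn (R : realType) (f : R -> R) (omega : nat -> R) (n : nat)
    (z : R * R) : R * R :=
  if n is m.+1 then torusF f (torusS (omega m) (torusFn f omega m z)) else z.

(* The library norm on R * R is the max norm. *)
Definition enorm (R : realType) (v : R * R) : R :=
  Num.sqrt (v.1 ^+ 2 + v.2 ^+ 2).

Definition opnorm (R : realType) (A : R * R -> R * R) : R :=
  sup [set enorm (A v) | v in [set v | enorm v <= 1]].

Definition cylinders (R : realType) : set (set (nat -> R)) :=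
  [set A | exists i (B : set R),
     measurable B /\ A = [set omega | B (omega i)]].

(* R^nat with its product sigma-algebra *)
Definition noise (R : realType) := g_sigma_algebraType (@cylinders R).

Lemma oppr_lt_self (R : realType) (eps : R) : 0 < eps -> - eps < eps.
Proof. by move=> e0; rewrite gtrN. Qed.

Definition nu (R : realType) (eps : R) (eps0 : 0 < eps) :
    probability (measurableTypeR R) R :=
  uniform_prob (oppr_lt_self eps0).

(* The infinite product of nu, as a measure on R^nat (it is carried by
   [-eps, eps]^nat), given by its values on finite-dimensional boxes, which
   determine it uniquely. *)
Definition is_noise_law (R : realType) (eps : R) (eps0 : 0 < eps)
    (P : probability (noise R) R) : Prop :=
  forall (n : nat) (B : nat -> set R), (forall i, measurable (B i)) ->
    P [set omega : noise R | forall i, (i < n)%N -> B i (omega i)] =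
    (\prod_(i < n) nu eps0 (B i))%E.

(* [lam] is the exponent lambda_1^eps, [P] being the law of the noise and
   [f] = f_(L,a). *)
Definition is_lambda1 (R : realType) (P : probability (noise R) R)
    (f : R -> R) (lam : R) : Prop :=
  forall z : R * R, {ae P, forall omega : noise R,
    (fun n : nat => n%:R^-1 * ln (opnorm ('d (torusFn f omega n) z)))
      @ \oo --> lam}.

(* Main.v *)
Require Import Defs.
From mathcomp Require Import all_boot all_order all_algebra.
From mathcomp Require Import all_classical all_reals all_analysis.
From mathcomp Require Import measurable_realfun.
From mathcomp Require Import ring lra zify.
Import Order.TTheory GRing.Theory Num.Theory.
Import numFieldNormedType.Exports.
Local Open Scope classical_set_scope.
Local Open Scope ring_scope.

(** Why the bound holds.

    Let X_n be the abscissa at which the n-th differential is taken.  The noisy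
    orbit satisfies X_(n+1) = f(X_n) - X_(n-1) + omega_(n+1), and a tangent
    vector (u_n, u_(n-1)) evolves by u_(n+1) = f'(X_n) u_n - u_(n-1).  Put
    K = L^((1 + alpha) / 2) and call the vector slow at time n when
    |u_n| < K |u_(n-1)|.  Between two consecutive times at which it is not slow,
    the vector grows by a factor K at least, and it never shrinks by more than a
    factor O(L) ([tangent_growth_count]).  So it is enough that, when the initial
    point is uniform on the torus, the event of being slow at time n has measure
    at most a small constant p (depending on alpha only) for every large n.
    Markov's inequality then gives, for every large n, an event of measure at
    least 1/2 on which the growth rate up to time n is at least alpha log L; a
    smaller exponent is impossible, since it would make the upper limit of these
    events a null set ([lambda1_ge]).

    To see that slow vectors are rare, fix N of order L^(2 - beta) and look back
    from time n = a + 2 + 2N to time a.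

    First, for a fixed noise the pair (X_k, X_(k-1)) is uniform on the torus,
    because every random map preserves area ([torus_prob_noisy]).  The product of
    two independent uniform slopes f'(X_k) f'(X_(k-1)) is smaller than L^(beta/2)
    with probability at most O(L^(3 beta / 4 - 2)) only ([torus_slope_product]),
    so that with high probability all the products of consecutive slopes are
    large during the 2N steps.  Working with products is what allows windows of
    length L^(2 - beta): a slope that is too small by itself is compensated by
    the next one.  Along such a window the solution w with w_a = 0 and
    w_(a+1) = 1 satisfies |w_(k+1)| >= |f'(X_k)| |w_k| / 2, hence is at least
    (L^(beta/2) / 4)^N at the end ([tangent_growth]).

    Secondly, u_k is an affine function of the slope c = f'(X_a) whose
    coefficient is u_a w_k when the other slopes are given.  The Wronskian of u
    and w is constant, which forces two values of c for which u_n is slow to be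
    exponentially close: their distance is at most 2 / (K w_(n-1)^2)
    ([tangent_slow_unique]).  On the other hand the noise is able to move X_a
    alone: add delta to omega_a, and compensate in omega_(a+1) and omega_(a+2)
    ([noisy_kick]).  This changes the law of the noise by O(L delta / eps) in
    total variation ([noise_law_kick]).  Take M values of delta, spaced by a
    small multiple of eps / L; away from the zeros of psi'' the M slopes that
    result are separated by a multiple of eps, which exceeds the exponentially
    small distance above as soon as eps >= L^(- (beta / 4) L^(2 - beta)).  The M
    perturbed copies of the slow event are therefore disjoint, and each has
    nearly the measure of the original one, which is thus at most 1 / M plus a
    small error ([slow_noise_measure]). *)

Set Implicit Arguments.
Unset Strict Implicit.
Unset Printing Implicit Defensive.

(** * Lebesgue measure under translations and on periodic sets *)

Lemma measurable_shift (R : realType) (c : R) (A : set R) :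
  measurable A -> measurable [set x | A (x + c)].
Proof.
move=> mA; rewrite -[X in measurable X]setTI.
by apply: (measurable_funD (@measurable_id _ _ _) (measurable_cst c)).
Qed.

Lemma lebesgue_measure_shift (R : realType) (c : R) (A : set R) :
  measurable A ->
  lebesgue_measure [set x | A (x + c)] = lebesgue_measure A :> \bar R.
Proof.
move=> mA.
pose T : measurableTypeR R -> measurableTypeR R := fun x => x + c.
have mT : measurable_fun setT T by exact: measurable_funD.
rewrite [LHS](_ : _ = pushforward (@lebesgue_measure R) T A)//.
apply/esym/lebesgue_measure_unique => //= _ [[a b]] _ <-.
rewrite /pushforward (_ : T @^-1` _ = `](a - c), (b - c)]%classic); last first.
  by apply/seteqP; split=> x; rewrite /T/= !in_itv/= ltrBlDr lerBrDr.
by rewrite !lebesgue_measure_itv/= !lte_fin ltrD2r -!EFinD opprB addrA subrK.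
Qed.

Lemma lebesgue_measure_le_point (R : realType) (b : R) (A B : set R) :
  measurable A -> measurable B -> A `<=` B `|` [set b] ->
  (lebesgue_measure A <= lebesgue_measure B :> \bar R)%E.
Proof.
move=> mA mB AB.
rewrite -[leRHS]adde0 -[X in (_ + X)%E](lebesgue_measure_set1 b).
apply: le_trans (measureU2 _ _ _) => //.
by rewrite le_measure ?inE//; apply: measurableU.
Qed.

Lemma uniform_probE (R : realType) (a b : R) (ab : a < b) (A : set R) :
  measurable A ->
  uniform_prob ab A =
    ((b - a)^-1%:E * lebesgue_measure (A `&` `[a, b[))%E.
Proof.
move=> mA; rewrite /uniform_prob integral_uniform_pdf.
rewrite (eq_integral (fun=> (b - a)^-1%:E)); last first.
  by move=> x; rewrite inE/= in_itv/= /uniform_pdf => -[_ ->].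
rewrite integral_cst//=; last by apply: measurableI.
congr (_ * _)%E.
apply/eqP; rewrite eq_le; apply/andP; split; last first.
  rewrite le_measure ?inE//; try exact: measurableI.
  by apply: setIS => x /=; rewrite !in_itv/= => /andP[-> /ltW ->].
apply: (@lebesgue_measure_le_point _ b); try exact: measurableI.
move=> x [Ax] /=; rewrite !in_itv/= => /andP[-> ].
by rewrite le_eqVlt => /orP[/eqP->|->]; [right|left].
Qed.

Lemma lebesgue_periodic_shift (R : realType) (c : R) (A : set R) :
  measurable A -> (forall x (k : int), A x -> A (x + k%:~R)) ->
  lebesgue_measure ([set x | A (x + c)] `&` `[0, 1[) =
  lebesgue_measure (A `&` `[0, 1[) :> \bar R.
Proof.
move=> mA perA.
wlog /andP[c0 c1] : c / 0 <= c < 1.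
  move=> /(_ (c - (Num.floor c)%:~R)) <-; last first.
    by rewrite subr_ge0 floor_le_tmp ltrBlDr addrC -intrD1 floorD1_gt.
  congr (lebesgue_measure (_ `&` _)); apply/seteqP; split => x /=.
    by move=> /(perA _ (- Num.floor c)); rewrite rmorphN/= addrA.
  by move=> /(perA _ (Num.floor c)); rewrite addrA subrK.
have mAc d : measurable [set x | A (x + d)] by exact: measurable_shift.
have -> : [set x | A (x + c)] `&` `[0, 1[ =
    [set x | (A `&` `[c, 1[) (x + c)] `|`
    [set x | (A `&` `[0, c[) (x + (c - 1))].
  apply/seteqP; split=> x /=; rewrite !in_itv/= ?addrA.
    move=> [Ax /andP[x0 x1]]; have [xc|xc] := ltP (x + c) 1.
      by left; split => //; rewrite lerDr x0.
    right; split; last by rewrite subr_ge0 xc/=; lra.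
    by have := perA _ (-1) Ax; rewrite rmorphN1.
  move=> [[Ax /andP[x0 x1]]|[Ax /andP[x0 x1]]].
    by split => //; apply/andP; split; lra.
  split; last by apply/andP; split; lra.
  by have := perA _ 1 Ax; rewrite subrK.
rewrite measureU; last 3 first.
- by apply: (@measurable_shift _ c (A `&` `[c, 1[)); apply: measurableI.
- by apply: (@measurable_shift _ (c - 1) (A `&` `[0, c[)); apply: measurableI.
- by apply/seteqP; split=> x //=; rewrite !in_itv/= => -[[_ ?] [_ ?]]; lra.
rewrite [X in (X + _)%E]lebesgue_measure_shift; last exact: measurableI.
rewrite [X in (_ + X)%E]lebesgue_measure_shift; last exact: measurableI.
rewrite -measureU//=; try by apply: measurableI.
  congr (lebesgue_measure _); rewrite -setIUr; congr (A `&` _).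
  apply/seteqP; split=> x /=; rewrite !in_itv/=; first by case; lra.
  by move=> ?; have [|] := ltP x c; [right|left]; lra.
by apply/seteqP; split=> x //=; rewrite !in_itv/= => -[[_ ?] [_ ?]]; lra.
Qed.

(** Reflection turns [0, 1[ into an interval that is open on the other side; the
    two kinds are compared up to an endpoint. *)
Lemma lebesgue_periodic_reflect (R : realType) (c : R) (A : set R) :
  measurable A -> (forall x (k : int), A x -> A (x + k%:~R)) ->
  lebesgue_measure ([set x | A (c - x)] `&` `[0, 1[) =
  lebesgue_measure (A `&` `[0, 1[) :> \bar R.
Proof.
move=> mA perA.
rewrite -(@lebesgue_periodic_shift _ (c - 1) A)//.
have mAc : measurable [set x | A (x + (c - 1))] by exact: measurable_shift.
have mAN : measurable [set x | A (c - x)].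
  rewrite -[X in measurable X]setTI.
  by apply: (measurable_funB (measurable_cst c) (@measurable_id _ _ _)).
rewrite -lebesgue_measureN; last exact: measurableI.
rewrite /pushforward -[LHS](@lebesgue_measure_shift _ (-1)); last first.
  rewrite -[X in measurable X]setTI.
  by apply: (measurable_funN (@measurable_id _ _ _)) => //; exact: measurableI.
have -> : [set x | (-%R @^-1` ([set x | A (c - x)] `&` `[0, 1[)) (x + -1)] =
    [set x | A (x + (c - 1))] `&` `]0, 1].
  apply/seteqP; split=> x /=; rewrite !in_itv/=;
    by rewrite (_ : c - - (x + -1) = x + (c - 1)); [case=> ? ?; split => //; lra|ring].
apply/eqP; rewrite eq_le; apply/andP; split.
  apply: (@lebesgue_measure_le_point _ 1); try exact: measurableI.
  move=> x [Ax /=]; rewrite !in_itv/= => /andP[/ltW -> ].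
  by rewrite le_eqVlt => /orP[/eqP->|->]; [right|left].
apply: (@lebesgue_measure_le_point _ 0); try exact: measurableI.
move=> x [Ax /=]; rewrite !in_itv/= => /andP[+ /ltW ->].
by rewrite le_eqVlt => /orP[/eqP->|->]; [right|left].
Qed.


(** The windows [a, b[ and [a - g, b - g[ differ by at most two intervals of
    length |g|; only one of them matters for an inequality. *)
Lemma uniform_prob_shift (R : realType) (a b : R) (ab : a < b) (g : R)
    (A : set R) : measurable A ->
  (uniform_prob ab A <=
    uniform_prob ab [set x | A (x + g)%R] + ((b - a)^-1 * `|g|)%:E)%E.
Proof.
move=> mA; have mAg : measurable [set x | A (x + g)] by exact: measurable_shift.
rewrite !uniform_probE// EFinM -muleDr//; last first.
  by rewrite ge0_adde_def// inE// lee_fin.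
apply: lee_wpmul2l; first by rewrite lee_fin invr_ge0 subr_ge0 ltW.
rewrite -(@lebesgue_measure_shift _ g); last exact: measurableI.
have H (c d : R) : c <= d -> d - c = `|g| ->
    [set x | (A `&` `[a, b[) (x + g)] `<=`
      ([set x | A (x + g)] `&` `[a, b[) `|` `[c, d[ ->
    (lebesgue_measure [set x | (A `&` `[a, b[) (x + g)%R] <=
     lebesgue_measure ([set x | A (x + g)%R] `&` `[a, b[) + `|g|%:E :> \bar R)%E.
  move=> cd dc sub.
  have -> : `|g|%:E = lebesgue_measure (`[c, d[ : set R).
    rewrite lebesgue_measure_itv/= lte_fin -dc EFinB.
    by case: ltgtP cd => // -> _; rewrite subee.
  apply: le_trans (measureU2 _ _ _) => //; last exact: measurableI.
  rewrite le_measure ?inE//.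
    by apply: (@measurable_shift _ g (A `&` `[a, b[)); exact: measurableI.
  by apply: measurableU => //; exact: measurableI.
have [g0|g0] := leP 0 g.
- apply: (H (a - g) a) => [||x [/= Ax]]; [lra|by rewrite ger0_norm//; lra|].
  rewrite !in_itv/= => /andP[x1 x2]; have [xa|xa] := ltP x a; [right|left].
    by rewrite lerBlDr x1.
  by split => //; apply/andP; split => //; lra.
- apply: (H b (b - g)) => [||x [/= Ax]]; [lra|by rewrite ltr0_norm//; lra|].
  rewrite !in_itv/= => /andP[x1 x2]; have [xb|xb] := ltP x b; [left|right].
    by split => //; apply/andP; split => //; lra.
  by rewrite ltrBrDr x2 andbT.
Qed.

(** * Resampling and translating one coordinate of the noise *)

Lemma measurable_noise_coord (R : realType) (i : nat) :
  measurable_fun [set: noise R] (fun omega : noise R => omega i).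
Proof.
move=> _ B mB; rewrite setTI.
by apply: sub_sigma_algebra; exists i, B; split.
Qed.

Lemma measurable_to_noise d (T : measurableType d) (R : realType)
    (h : T -> noise R) :
  (forall i, measurable_fun setT (fun t => h t i : R)) ->
  measurable_fun setT h.
Proof.
move=> mh.
have mE : (measurable : set (set (noise R))) = <<s @cylinders R >> by [].
apply: (measurability _ mE) => // _ [_ [i [B [mB ->]]] <-].
exact: mh.
Qed.

Definition noise_set (R : realType) (k : nat) (t : R) (omega : nat -> R) :
  nat -> R := fun i => if i == k then t else omega i.

Lemma measurable_noise_set (R : realType) k d (T : measurableType d)
    (g : T -> R) (h : T -> noise R) :
  measurable_fun setT g -> measurable_fun setT h ->
  measurable_fun setT (fun t => noise_set k (g t) (h t) : noise R).
Proof.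
move=> mg mh; apply: measurable_to_noise => i; rewrite /noise_set.
case: eqP => _ //.
exact: (measurableT_comp (@measurable_noise_coord R i) mh).
Qed.

Definition noise_box (R : realType) (n : nat) (B : nat -> set R) :
  set (noise R) := [set omega : noise R | forall i, (i < n)%N -> B i (omega i)].

Lemma noise_box_measurable (R : realType) n (B : nat -> set R) :
  (forall i, measurable (B i)) -> measurable (@noise_box R n B).
Proof.
move=> mB; rewrite /noise_box.
rewrite (_ : mkset _ =
    \bigcap_(i in `I_n) [set omega : noise R | B i (omega i)]); last first.
  by apply/seteqP; split.
apply: bigcap_measurableType => i _.
by rewrite -[X in measurable X]setTI; apply: measurable_noise_coord.
Qed.

(** Independence of one coordinate from the others, in the only form that is
    needed: replacing a coordinate by a fresh one does not change the law.  Both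
    sides are measures that agree on finite-dimensional boxes. *)
Lemma noise_law_resample (R : realType) (eps : R) (eps0 : 0 < eps)
    (P : probability (noise R) R) (k : nat) (A : set (noise R)) :
  is_noise_law eps0 P -> measurable A ->
  P A = (\int[P]_omega nu eps0 [set t | A (noise_set k t omega)])%E.
Proof.
move=> lawP mA.
pose h (z : noise R * measurableTypeR R) : noise R := noise_set k z.2 z.1.
have mh : measurable_fun setT h by apply: measurable_noise_set.
transitivity (pushforward (P \x nu eps0)%E h A); last first.
  rewrite /pushforward /product_measure1; apply: eq_integral => omega _ /=.
  by rewrite xsectionE.
pose G := [set C | exists n B, (forall i, measurable (B i)) /\ C = @noise_box R n B].
have mG : measurable = <<s G >>.
  apply/seteqP; split.
    apply: smallest_sub; first exact: smallest_sigma_algebra.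
    move=> _ [i [B [mB ->]]]; apply: sub_sigma_algebra.
    exists i.+1, (fun j => if j == i then B else setT); split.
      by move=> j; case: ifP.
    apply/seteqP; split=> omega /= Bo; first by move=> j _; case: eqP => // ->.
    by have := Bo i (leqnn _); rewrite eqxx.
  apply: smallest_sub; first exact: sigma_algebra_measurable.
  by move=> _ [n [B [mB ->]]]; exact: noise_box_measurable.
apply: (measure_unique G (fun=> setT) mG) => //.
- move=> _ _ [n [B [mB ->]]] [n' [B' [mB' ->]]].
  exists (maxn n n'), (fun i => (if (i < n)%N then B i else setT) `&`
    (if (i < n')%N then B' i else setT)); split.
    by move=> i; apply: measurableI; case: ifP.
  apply/seteqP; split=> omega /=.
    by move=> [H H'] i _; split; case: ifP => // ?; [exact: H|exact: H'].
  move=> H; split=> i ilt.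
    have := H i (leq_trans ilt (leq_maxl _ _)); rewrite ilt; by case.
  have := H i (leq_trans ilt (leq_maxr _ _)); rewrite ilt; by case.
- by move=> i; exists 0%N, (fun=> setT); split => //; apply/seteqP; split.
- by rewrite bigcup_const.
- move=> _ [n [B [mB ->]]].
  pose B' i := if i == k then setT else B i.
  have mB' i : measurable (B' i) by rewrite /B'; case: ifP.
  pose D := if (k < n)%N then B k else setT.
  have mD : measurable D by rewrite /D; case: ifP.
  have hE : h @^-1` noise_box n B = noise_box n B' `*` D.
    apply/seteqP; split=> -[omega t]; rewrite /h /noise_box /noise_set /=.
      move=> H; split.
        by move=> i ilt; rewrite /B'; have := H i ilt; case: eqP.
      by rewrite /D; case: ifP => // kn; have := H k kn; rewrite eqxx.
    move=> [H1 H2] i ilt; case: eqP => [ik|ik].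
      by move: H2; rewrite /D -ik ilt.
    by have := H1 i ilt; rewrite /B'; case: eqP.
  rewrite [RHS]/(pushforward _ _ _) hE [RHS]product_measure1E//; last exact: noise_box_measurable.
  rewrite [LHS](lawP n B mB) [X in _ = (X * _)%E](lawP n _ mB') /D.
  have [kn|kn] := ltnP k n; last first.
    rewrite [X in _ = (_ * X)%E](@probability_setT _ _ _ (nu eps0)) mule1.
    apply: eq_bigr => i _.
    by rewrite /B'; case: eqP => // ik; have := ltn_ord i; rewrite ik ltnNge kn.
  rewrite (bigD1 (Ordinal kn))//= [in RHS](bigD1 (Ordinal kn))//=.
  rewrite {1}/B' eqxx (@probability_setT _ _ _ (nu eps0)) mul1e muleC; congr (_ * _)%E.
  by apply: eq_bigr => i ik; rewrite /B' -[k]/(val (Ordinal kn)) val_eqE (negbTE ik).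
- by move=> i /=; rewrite (@probability_setT _ _ _ P) ltry.
Qed.

(** A coordinate may be translated by an amount that depends on the others: given
    the others it is still uniform, on a window that has moved by at most D. *)
Lemma noise_law_shift_coord (R : realType) (eps : R) (eps0 : 0 < eps)
    (P : probability (noise R) R) (k : nat) (g : (nat -> R) -> R) (D : R)
    (A : set (noise R)) :
  is_noise_law eps0 P -> measurable A ->
  measurable_fun setT (g : noise R -> R) ->
  (forall omega t, g (noise_set k t omega) = g omega) ->
  (forall omega, `|g omega| <= D) ->
  (P A <= P [set omega | A (noise_set k (omega k + g omega)%R omega)] +
    (D / (2 * eps))%:E)%E.
Proof.
move=> lawP mA mg gk gD.
have mT : measurable_fun setT
    (fun omega : noise R => noise_set k (omega k + g omega) omega : noise R).
  apply: measurable_noise_set => //; apply: measurable_funD => //.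
  exact: measurable_noise_coord.
have mTA : measurable [set omega : noise R |
    A (noise_set k (omega k + g omega) omega)].
  by rewrite -[X in measurable X]setTI; exact: mT.
rewrite (noise_law_resample k lawP mA).
rewrite (noise_law_resample k lawP mTA).
pose h (z : noise R * measurableTypeR R) : noise R := noise_set k z.2 z.1.
have mh : measurable_fun setT h by apply: measurable_noise_set.
have mI (B : set (noise R)) : measurable B ->
    measurable_fun setT (fun omega : noise R => nu eps0 [set t | B (noise_set k t omega)]).
  move=> mB; rewrite (_ : (fun _ => _) = nu eps0 \o xsection (h @^-1` B)).
    apply: measurable_fun_xsection.
    by rewrite -[X in measurable X]setTI; exact: mh.
  by apply/funext => omega /=; rewrite xsectionE.
have D0 : 0 <= D by apply: le_trans (gD (fun=> 0)).
have -> : (D / (2 * eps))%:E = (\int[P]_omega (cst (D / (2 * eps))%:E omega))%E.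
  by rewrite integral_cst// [X in (_ * X)%E](@probability_setT _ _ _ P) mule1.
rewrite -ge0_integralD//; last 2 first.
- by apply: (mI _ mTA).
- by move=> x _ /=; rewrite lee_fin divr_ge0// mulr_ge0// ltW.
apply: ge0_le_integral => //.
- by apply: (mI _ mA).
- by apply: emeasurable_funD => //; apply: (mI _ mTA).
move=> omega _ /=.
have ms : measurable [set t : R | A (noise_set k t omega)].
  rewrite -[X in measurable X]setTI.
  by apply: (@measurable_noise_set R k _ _ id (cst omega)).
apply: le_trans (uniform_prob_shift (oppr_lt_self eps0) (g omega) ms) _.
rewrite leeD//; last first.
  rewrite lee_fin (_ : eps - - eps = 2 * eps); last by ring.
  by rewrite [leLHS]mulrC ler_wpM2r// invr_ge0 mulr_ge0// ltW.
rewrite le_eqVlt; apply/orP; left; apply/eqP; congr (uniform_prob _ _).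
apply: eq_set => t; rewrite gk; congr A.
by apply/funext => i; rewrite /noise_set eqxx; case: eqP.
Qed.

(** * The tangent recursion *)

(** The pair (u_n, u_(n-1)) for the recursion u_(n+1) = v_n u_n - u_(n-1), which
    the differentials of the torus maps obey. *)
Fixpoint tangent (R : realType) (v : nat -> R) (e : R * R) (n : nat) : R * R :=
  if n is m.+1
  then (v m * (tangent v e m).1 - (tangent v e m).2, (tangent v e m).1)
  else e.

Lemma tangentD (R : realType) (v : nat -> R) (e : R * R) (m n : nat) :
  tangent v e (m + n) = tangent (fun k => v (m + k)%N) (tangent v e m) n.
Proof. by elim: n => [|n IHn]; rewrite ?addn0// addnS/= IHn. Qed.

Lemma eq_tangent (R : realType) (v v' : nat -> R) (e : R * R) (n : nat) :
  (forall k, (k < n)%N -> v k = v' k) -> tangent v e n = tangent v' e n.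
Proof.
elim: n => // n IHn vv' /=; rewrite vv'// IHn// => k kn.
by apply: vv'; rewrite ltnW.
Qed.

Lemma tangent_wronskian (R : realType) (v : nat -> R) (e e' : R * R) n :
  (tangent v e n).1 * (tangent v e' n).2 -
  (tangent v e n).2 * (tangent v e' n).1 = e.1 * e'.2 - e.2 * e'.1.
Proof. by elim: n => // n <- /=; ring. Qed.

Lemma tangent_lin (R : realType) (v : nat -> R) (c c' p q : R) n :
  (tangent v (c * p - q, p) n).2 - (tangent v (c' * p - q, p) n).2 =
  (c - c') * p * (tangent v (1, 0) n).2.
Proof.
suff [//] : (tangent v (c * p - q, p) n).2 - (tangent v (c' * p - q, p) n).2 =
  (c - c') * p * (tangent v (1, 0) n).2 /\
  (tangent v (c * p - q, p) n).1 - (tangent v (c' * p - q, p) n).1 =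
  (c - c') * p * (tangent v (1, 0) n).1.
elim: n => [|n [IH2 IH1]] /=; first by split; ring.
split => //.
transitivity (v n * ((tangent v (c * p - q, p) n).1 -
    (tangent v (c' * p - q, p) n).1) - ((tangent v (c * p - q, p) n).2 -
    (tangent v (c' * p - q, p) n).2)); first by ring.
by rewrite IH1 IH2; ring.
Qed.

(** The cone |u_(m+1)| >= |v_m| |u_m| / 2 is invariant as soon as the product of
    two consecutive slopes is at least 4: the loss 1 / |u_(m+1) / u_m| is at most
    2 / |v_m|, which is at most |v_(m+1)| / 2.  Two steps in the cone multiply the
    vector by a quarter of the product of two slopes. *)
Lemma tangent_growth (R : realType) (v : nat -> R) (theta : R) (N : nat) :
  4 <= theta -> (forall m, (m < N.*2)%N -> theta <= `|v m.+1 * v m|) ->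
  v 0%N != 0 ->
  let w := tangent v (1, 0) N.*2.+1 in
  `|v N.*2| / 2 * `|w.2| <= `|w.1| /\ (theta / 4) ^+ N <= `|w.2|.
Proof.
move=> theta4 vv v0 /=.
have cone m : (m <= N.*2)%N -> let w := tangent v (1, 0) m.+1 in
    `|v m| / 2 * `|w.2| <= `|w.1|.
  elim: m => [_|m IHm mN]; rewrite /=.
    by rewrite mulr1 subr0 normr1 mulr1 ler_pdivrMr// ler_peMr// ler1n.
  have := IHm (ltnW mN); rewrite /=.
  set p := v m * _ - _; set q := (tangent v (1, 0) m).1 => IH.
  have := vv m mN; rewrite normrM => th.
  have vm0 : 0 < `|v m|.
    by rewrite normr_gt0; apply: contraTneq th => ->; rewrite normr0 mulr0 -ltNge; lra.
  have q_le : `|q| <= `|v m.+1| / 2 * `|p|.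
    rewrite -(ler_pM2l vm0) mulrCA -mulrA.
    have := normr_ge0 p; have := normr_ge0 q; nra.
  have := lerB_dist (v m.+1 * p) q; rewrite normrM; lra.
split; first exact: cone.
have {}vv m : (m <= N)%N -> (theta / 4) ^+ m <= `|(tangent v (1, 0) m.*2.+1).2|.
  elim: m => [_|m IHm mN]; first by rewrite expr0/= normr1.
  have := IHm (ltnW mN) => IH.
  have h1 : (m.*2.+1 <= N.*2)%N by lia.
  have h2 : (m.*2 < N.*2)%N by [].
  have := cone _ h1; have := cone _ (ltnW h2); have := vv _ h2.
  rewrite doubleS /= exprS normrM.
  set p := v m.*2 * _ - _; set p' := v m.*2.+1 * p - _.
  set q := (tangent v (1, 0) m.*2).1 => th h3 h4.
  apply: le_trans h4; rewrite -[q]/((tangent v (1, 0) m.*2.+1).2) in h3.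
  apply: (@le_trans _ _ (`|v m.*2.+1| / 2 * (`|v m.*2| / 2 * `|q|))); last first.
    by rewrite ler_wpM2l// divr_ge0.
  rewrite (_ : _ / 2 * _ = (`|v m.*2.+1| * `|v m.*2| / 4) * `|q|); last by field.
  apply: ler_pM => //; first by rewrite divr_ge0//; lra.
    by rewrite exprn_ge0// divr_ge0//; lra.
  by rewrite ler_pM2r.
exact: vv.
Qed.

(** The Wronskian of a slow solution t and of the fast solution w equals -p, so
    that t.2 is at most |p| / (K |w.2|).  But the difference of the second
    components for two values of the parameter is (c - c') p w.2. *)
Lemma tangent_slow_unique (R : realType) (v : nat -> R) (K c c' p q : R) n :
  let w := tangent v (1, 0) n in
  let t := tangent v (c * p - q, p) n in
  let t' := tangent v (c' * p - q, p) n in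
  0 < K -> 2 * K * `|w.2| <= `|w.1| -> w.2 != 0 ->
  `|t.1| < K * `|t.2| -> `|t'.1| < K * `|t'.2| ->
  `|c - c'| * (K * `|w.2| ^+ 2) <= 2.
Proof.
move=> w t t' K0 wK w0 tK t'K.
have w2 : 0 < `|w.2| by rewrite normr_gt0.
have slow d : `|(tangent v (d * p - q, p) n).1| <
    K * `|(tangent v (d * p - q, p) n).2| ->
    K * `|w.2| * `|(tangent v (d * p - q, p) n).2| <= `|p|.
  move=> dK.
  have := tangent_wronskian v (d * p - q, p) (1, 0) n; rewrite -/w/=.
  set s := tangent v _ n in dK *; rewrite mulr0 mulr1 sub0r => /(congr1 Num.norm).
  rewrite normrN => <-; rewrite distrC; apply: le_trans (lerB_dist _ _).
  rewrite !normrM; have := normr_ge0 s.2; nra.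
have h := slow _ tK; have h' := slow _ t'K.
have p0 : 0 < `|p|.
  rewrite lt_neqAle normr_ge0 andbT; apply: contraTneq tK => p0.
  rewrite -leNgt; apply: le_trans (normr_ge0 _).
  have : `|t.2| <= 0.
    by move: h; rewrite -p0 pmulr_rle0// mulr_gt0.
  by move=> h2; rewrite pmulr_rle0.
have := tangent_lin v c c' p q n; rewrite -/w -/t -/t' => /(congr1 Num.norm).
rewrite !normrM => e.
have : `|t.2 - t'.2| <= `|t.2| + `|t'.2| by exact: ler_normB.
rewrite e => e'; rewrite -(ler_pM2r p0).
have Kw : 0 < K * `|w.2| by exact: mulr_gt0.
rewrite (_ : _ * _ * `|p| = K * `|w.2| * (`|c - c'| * `|p| * `|w.2|)); last by ring.
by apply: le_trans (ler_wpM2l (ltW Kw) e') _; rewrite mulrDr; lra.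
Qed.

(** * Moving a single point of the noisy orbit *)

(** The orbit right after the n-th translation S: its first component is the
    abscissa X_n where the slope is read, and its second one is X_(n-1). *)
Definition noisy (R : realType) (f : R -> R) (omega : nat -> R) (z : R * R)
  (n : nat) : R * R := torusS (omega n) (torusFn f omega n z).

Lemma noisyS (R : realType) (f : R -> R) omega z n :
  noisy f omega z n.+1 =
  (f (noisy f omega z n).1 - (noisy f omega z n).2 + omega n.+1,
   (noisy f omega z n).1).
Proof. by []. Qed.

Lemma eq_noisy (R : realType) (f : R -> R) omega omega' z n :
  (forall k, (k <= n)%N -> omega k = omega' k) ->
  noisy f omega z n = noisy f omega' z n.
Proof.
elim: n => [|n IHn] oo; first by rewrite /noisy/= oo.
by rewrite !noisyS IHn ?oo// => k kn; rewrite oo// ltnW.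
Qed.

(** The kick adds delta to X_a.  The recursion
    X_(n+1) = f(X_n) - X_(n-1) + omega_(n+1) feels X_a twice, in X_(a+1) and in
    X_(a+2), and the next two coordinates of the noise cancel both effects. *)
Definition noise_kick (R : realType) (f : R -> R) (z : R * R) (a : nat)
    (delta : R) (omega : nat -> R) : nat -> R :=
  let x := (noisy f omega z a).1 in
  noise_set a (omega a + delta)
    (noise_set a.+1 (omega a.+1 + (f x - f (x + delta)))
      (noise_set a.+2 (omega a.+2 + delta) omega)).

Lemma noisy_kick (R : realType) (f : R -> R) (z : R * R) (a : nat)
    (delta : R) (omega : nat -> R) n :
  (noisy f (noise_kick f z a delta omega) z n).1 =
  (noisy f omega z n).1 + delta *+ (n == a).
Proof.
set omega' := noise_kick _ _ _ _ _.
have lt_a k : (k < a)%N -> omega' k = omega k.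
  by rewrite /omega' /noise_kick /noise_set; do 3![case: eqP => [?|_]; first lia].
have gt_a k : (a.+2 < k)%N -> omega' k = omega k.
  by rewrite /omega' /noise_kick /noise_set; do 3![case: eqP => [?|_]; first lia].
have eq_a : omega' a = omega a + delta.
  by rewrite /omega' /noise_kick /noise_set eqxx.
have eq_a1 : omega' a.+1 = omega a.+1 +
    (f (noisy f omega z a).1 - f ((noisy f omega z a).1 + delta)).
  rewrite /omega' /noise_kick /noise_set eqxx; case: eqP => // ?; lia.
have eq_a2 : omega' a.+2 = omega a.+2 + delta.
  rewrite /omega' /noise_kick /noise_set eqxx.
  by do 2![case: eqP => [?|_]; first lia].
have [na|an] := ltnP n a.
  rewrite (_ : (n == a) = false) ?mulr0n ?addr0; last by apply/eqP; lia.
  by congr (_.1); apply: eq_noisy => k kn; apply: lt_a; lia.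
(* Only X_a has moved at time a; one step later it is X_a, now the second
   component, that differs; then the orbits coincide. *)
have a0 : noisy f omega' z a = ((noisy f omega z a).1 + delta, (noisy f omega z a).2).
  case: (a) lt_a eq_a => [|b] lt_b eq_b; first by rewrite /noisy /torusS /= eq_b addrA.
  rewrite !noisyS eq_b addrA (@eq_noisy _ _ omega' omega).
    by [].
  by move=> k kb; exact: lt_b.
have a1 : noisy f omega' z a.+1 =
    ((noisy f omega z a.+1).1, (noisy f omega z a.+1).2 + delta).
  by rewrite !noisyS a0 eq_a1 /=; congr pair; ring.
have a2 k : noisy f omega' z (a.+2 + k) = noisy f omega z (a.+2 + k).
  elim: k => [|k IHk]; last by rewrite addnS [LHS]noisyS [RHS]noisyS IHk gt_a//; lia.
  by rewrite addn0 [LHS]noisyS [RHS]noisyS a1 eq_a2 /=; congr pair; ring.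
have [->|na] := eqVneq n a; first by rewrite a0.
rewrite addr0; have [->|na1] := eqVneq n a.+1; first by rewrite a1.
by rewrite (_ : n = (a.+2 + (n - a.+2))%N) ?a2//; move/eqP: na na1 => ? /eqP; lia.
Qed.

Lemma measurable_noisy (R : realType) (f : R -> R) d (T : measurableType d)
    (omega : T -> noise R) (z : T -> R * R) n :
  measurable_fun setT f -> measurable_fun setT omega ->
  measurable_fun setT (fun t => (z t).1) ->
  measurable_fun setT (fun t => (z t).2) ->
  measurable_fun setT (fun t => (noisy f (omega t) (z t) n).1) /\
  measurable_fun setT (fun t => (noisy f (omega t) (z t) n).2).
Proof.
move=> mf mo m1 m2.
have mo' k : measurable_fun setT (fun t => omega t k : R).
  exact: (measurableT_comp (@measurable_noise_coord R k) mo).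
elim: n => [|n [IH1 IH2]].
  by split; [apply: measurable_funD|].
split; last exact: IH1.
under eq_fun do rewrite noisyS /=.
apply: measurable_funD => //; apply: measurable_funB => //.
exact: (measurableT_comp mf IH1).
Qed.

Lemma measurable_tangent (R : realType) d (T : measurableType d)
    (v : T -> nat -> R) (e : R * R) n :
  (forall k, measurable_fun setT (fun t => v t k)) ->
  measurable_fun setT (fun t => (tangent (v t) e n).1) /\
  measurable_fun setT (fun t => (tangent (v t) e n).2).
Proof.
move=> mv; elim: n => [|n [IH1 IH2]]; first by split; exact: measurable_cst.
split => //=; apply: measurable_funB => //; exact: measurable_funM.
Qed.

(** The kick is a composition of three translations of one coordinate, each by an
    amount that the moved coordinate does not enter. *)
Lemma noise_law_kick (R : realType) (eps : R) (eps0 : 0 < eps)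
    (P : probability (noise R) R) (f : R -> R) (z : R * R) (a : nat)
    (delta D : R) (A : set (noise R)) :
  is_noise_law eps0 P -> measurable_fun setT f ->
  (forall x, `|f x - f (x + delta)| <= D) -> measurable A ->
  (P A <= P [set omega | A (noise_kick f z a delta omega)] +
    ((2 * `|delta| + D) / (2 * eps))%:E)%E.
Proof.
move=> lawP mf fD mA.
have mS k (h : noise R -> R) : measurable_fun setT h ->
    measurable_fun setT
      (fun omega : noise R => noise_set k (omega k + h omega) omega : noise R).
  move=> mh; apply: measurable_noise_set => //; apply: measurable_funD => //.
  exact: measurable_noise_coord.
pose x (omega : noise R) := (noisy f omega z a).1.
have mx : measurable_fun setT x.
  by apply: (measurable_noisy a mf _ _ _).1.
pose g omega := f (x omega) - f (x omega + delta).
have mg : measurable_fun setT g.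
  apply: measurable_funB; first exact: measurableT_comp.
  by apply: (measurableT_comp mf); exact: measurable_funD.
pose A1 := [set omega : noise R | A (noise_set a (omega a + delta) omega)].
have mA1 : measurable A1.
  by rewrite -[X in measurable X]setTI; apply: (mS a (cst delta)).
pose A2 := [set omega : noise R | A1 (noise_set a.+1 (omega a.+1 + g omega) omega)].
have mA2 : measurable A2.
  by rewrite -[X in measurable X]setTI; apply: (mS a.+1 g).
have := @noise_law_shift_coord _ _ eps0 P a (cst delta) `|delta| A lawP mA
  (measurable_cst _) (fun _ _ => erefl) (fun=> lexx _).
have := @noise_law_shift_coord _ _ eps0 P a.+1 g D A1 lawP mA1 mg _ (fun=> fD _).
move=> /(_ _)/wrap[].
  move=> omega t; rewrite /g /x (@eq_noisy _ f (noise_set a.+1 t omega) omega)//.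
  by move=> k ka; rewrite /noise_set; case: eqP => // ?; lia.
have := @noise_law_shift_coord _ _ eps0 P a.+2 (cst delta) `|delta| A2 lawP mA2
  (measurable_cst _) (fun _ _ => erefl) (fun=> lexx _).
rewrite -/A1 -/A2 => h2 h1 h0.
apply: le_trans h0 _; apply: le_trans (leeD2r _ h1) _.
apply: le_trans (leeD2r _ (leeD2r _ h2)) _.
rewrite -!addeA -!EFinD.
have -> : `|delta| / (2 * eps) + (D / (2 * eps) + `|delta| / (2 * eps)) =
  (2 * `|delta| + D) / (2 * eps) by ring.
rewrite leeD2r// le_eqVlt; apply/orP; left; apply/eqP; congr (P _).
apply: eq_set => omega; rewrite /A2 /A1 /=; congr A.
have e : x (noise_set a.+2 (omega a.+2 + delta) omega) = x omega.
  rewrite /x (@eq_noisy _ f _ omega)// => k ka.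
  by rewrite /noise_set; case: eqP => // ?; lia.
rewrite /noise_kick -/(x omega) /g e; congr (noise_set _ (_ + _) (noise_set _ (_ + _) _)).
  by rewrite /noise_set; do 2![case: eqP => [?|_]; first lia].
by rewrite /noise_set; case: eqP => // ?; lia.
Qed.

(** * Sublevel sets of nondegenerate periodic functions *)

Lemma measurable_boolset d (T : measurableType d) (b : T -> bool) :
  measurable_fun setT b -> measurable [set x | b x].
Proof.
move=> mb; rewrite -[X in measurable X]setTI.
by rewrite (_ : [set x | b x] = b @^-1` [set true])//; exact: mb.
Qed.

Lemma periodic_int (R : realType) (V : zmodType) (g : R -> V) (k : int) (x : R) :
  periodic g 1 -> g (x + k%:~R) = g x.
Proof.
move=> perg; have pn n y : g (y + n%:R) = g y.
  by elim: n => [|n IHn]; rewrite ?addr0// -natr1 addrA perg.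
by case: k => n; rewrite ?pmulrn ?NegzE ?mulrNz -?pmulrn ?pn// -(pn n.+1) subrK.
Qed.

Lemma periodic_bounded (R : realType) (g : R -> R) :
  continuous g -> periodic g 1 -> exists2 M : R, 0 < M & forall x, `|g x| <= M.
Proof.
move=> cg perg.
have cng : continuous (fun x => `|g x|).
  by move=> x; apply: (continuous_comp (cg x)); exact: norm_continuous.
have [c _ cmax] := @EVT_max R _ 0 1 ler01 (continuous_subspaceT cng).
exists (`|g c| + 1); first by rewrite ltr_wpDl.
move=> x; rewrite -(periodic_int (- Num.floor x) x perg).
rewrite (le_trans (cmax _ _)) ?lerDl//.
by rewrite in_itv/= rmorphN/= subr_ge0 floor_le_tmp lerBlDr addrC -intrD1 ltW// floorD1_gt.
Qed.

Lemma is_derive_periodic (R : realType) (g : R -> R) :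
  (forall x, derivable g x 1) -> periodic g 1 -> periodic (derive1 g) 1.
Proof.
move=> dg perg x.
have e : (g \o shift 1) = g by apply/funext => y /=; exact: perg.
have ds : is_derive x (1 : R) (shift (1 : R)) 1.
  rewrite (_ : shift 1 = id + cst (1 : R))//.
  by apply: is_derive_eq; rewrite addr0.
have dg1 : is_derive (shift 1 x) (1 : R) g (derive1 g (x + 1)).
  by rewrite derive1E; exact/derivableP.
have := is_derive1_comp dg1 ds.
by rewrite e mulr1 => -[_ <-]; rewrite derive1E.
Qed.

Section c1_function.
Variables (R : realType) (g dg : R -> R).
Hypothesis gdg : forall x : R, is_derive x (1 : R) g (dg x).

Lemma is_derive_continuous : continuous g.
Proof.
by move=> x; apply/differentiable_continuous/derivable1_diffP/ex_derive.
Qed.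

Lemma increment_ge (x y m : R) :
  (forall t, Num.min x y <= t <= Num.max x y -> m <= `|dg t|) ->
  m * `|x - y| <= `|g x - g y|.
Proof.
wlog xy : x y / y <= x => [H|].
  have /orP[|] := le_total y x; first exact: H.
  move=> xy.
  by rewrite (distrC x) (distrC (g x)) minC maxC; exact: H.
rewrite (min_idPr xy) (max_idPl xy) => mt.
have [c cxy ->] := MVT_segment xy (fun x _ => gdg x)
  (continuous_subspaceT is_derive_continuous).
by rewrite normrM ler_wpM2r// mt//; move: cxy; rewrite in_itv.
Qed.

Lemma increment_le (x y m : R) :
  (forall t, `|dg t| <= m) -> `|g x - g y| <= m * `|x - y|.
Proof.
wlog xy : x y / y <= x => [H|].
  have /orP[|] := le_total y x; first exact: H.
  move=> xy.
  by rewrite (distrC x) (distrC (g x)); exact: H.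
move=> mt.
have [c cxy ->] := MVT_segment xy (fun x _ => gdg x)
  (continuous_subspaceT is_derive_continuous).
by rewrite normrM ler_wpM2r.
Qed.

Hypothesis cdg : continuous dg.
Hypothesis nondeg : forall x, g x = 0 -> dg x != 0.

(** Near every point either g or its derivative is bounded away from 0; the radius
    and the bound are made uniform by compactness. *)
Lemma uniform_nondegenerate : exists2 r : R, 0 < r & forall x, 0 <= x <= 1 ->
  (forall y, `|y - x| < r -> r <= `|g y|) \/
  (forall y, `|y - x| < r -> r <= `|dg y|).
Proof.
pose Q (r x : R) := (forall y, `|y - x| < r -> r <= `|g y|) \/
  (forall y, `|y - x| < r -> r <= `|dg y|).
suff : \forall r \near 0^'+, `[0, 1]%classic `<=` Q r.
  move=> H; near (0 : R)^'+ => r.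
  exists r => // x x01; have : `[0, 1]%classic `<=` Q r by near: r.
  by apply; rewrite /= in_itv.
have [ncov _] := @compact_near_coveringP R `[0, 1].
apply: (ncov (@segment_compact R 0 1)) => x _.
have key (h : R -> R) : continuous h -> h x != 0 ->
    \forall x' \near x & r \near (0 : R)^'+,
      forall y, `|y - x'| < r -> r <= `|h y|.
  move=> ch hx.
  have [e /= e0 he] : \forall y \near x, `|h x| / 2 < `|h y|.
    apply: (@cvgr_gt R R (nbhs x) _ (fun y => `|h y|) `|h x|).
      by apply: (continuous_comp (ch x)); exact: norm_continuous.
    by rewrite gtr_pMr ?normr_gt0//; lra.
  exists (ball x (e / 2), [set r | 0 < r < Num.min (e / 2) (`|h x| / 2)]) => /=.
    split; first by apply: nbhsx_ballx; rewrite divr_gt0.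
    near=> r; rewrite /=; apply/andP; split => //; near: r.
    by apply: nbhs_right_lt; rewrite lt_min !divr_gt0 ?normr_gt0.
  move=> [x' r] [/= xx' /andP[r0]]; rewrite lt_min => /andP[re rh] y yx'.
  apply/ltW/(lt_trans rh)/he; rewrite /= /ball_ in xx' *.
  rewrite (_ : x - y = (x - x') - (y - x')); last by ring.
  by apply: le_lt_trans (ler_normB _ _) _; rewrite [ltRHS]splitr ltrD// (lt_trans yx').
have [gx|gx] := eqVneq (g x) 0.
- apply: filterS (key dg cdg (nondeg gx)) => -[x' r] /= H; by right.
- apply: filterS (key g is_derive_continuous gx) => -[x' r] /= H; by left.
Unshelve. all: by end_near.
Qed.

Lemma sublevel_measurable (t : R) : measurable [set x | `|g x| <= t].
Proof.
apply: measurable_boolset; apply: measurable_fun_ler => //.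
apply: measurableT_comp => //; apply: continuous_measurable_fun.
exact: is_derive_continuous.
Qed.

(** On a short interval, either the sublevel set is empty for small t, or g is
    monotone with derivative at least r and the set has diameter at most 2 t / r. *)
Lemma sublevel_measure : exists2 C : R, 0 < C & forall t : R, 0 < t ->
  (lebesgue_measure ([set x | `|g x|%R <= t] `&` `[0, 1[)%R <= (C * t)%:E :> \bar R)%E.
Proof.
have [r r0 hr] := uniform_nondegenerate.
pose C := 2 + 4 / r.
have C0 : 0 < C by rewrite addr_gt0// divr_gt0.
pose S (t x : R) := [set y | `|g y| <= t] `&` `[x, x + r[.
have mS (t x : R) : measurable (S t x).
  by apply: measurableI => //; exact: sublevel_measurable.
have loc (x t : R) : 0 <= x <= 1 -> 0 < t ->
    (lebesgue_measure (S t x) <= (C * t)%:E :> \bar R)%E.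
  move=> x01 t0.
  have [->|/set0P[y0 Sy0]] := eqVneq (S t x) set0.
    by rewrite measure0 lee_fin mulr_ge0// ltW.
  have Sx y : S t x y -> `|y - x| < r.
    by move=> [_]; rewrite /= in_itv/= => ?; rewrite ger0_norm; lra.
  have [h|h] := hr x x01.
    have rt : r <= t by apply: le_trans (h _ (Sx _ Sy0)) _; case: Sy0.
    apply: (@le_trans _ _ (lebesgue_measure (`[x, x + r[%classic : set R))).
      by apply: le_measure; rewrite ?inE//; [exact: mS|exact: subIsetr].
    rewrite lebesgue_measure_itv/= lte_fin ltrDl r0 -EFinB lee_fin addrC addKr.
    have h4 : 0 <= 4 / r * t by rewrite mulr_ge0 ?divr_ge0// ltW.
    by rewrite /C mulrDl; lra.
  apply: (@le_trans _ _ (lebesgue_measure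
      (`[y0 - 2 * t / r, y0 + 2 * t / r]%classic : set R))).
    apply: le_measure; rewrite ?inE//; first exact: mS.
    move=> y Sy.
    have : r * `|y - y0| <= `|g y - g y0|.
      apply: increment_ge => s ys; apply: h.
      move: (Sy) (Sy0) => [_ +] [_]; rewrite /= !in_itv/=.
      move=> /andP[y1 y2] /andP[y3 y4]; case/andP: ys => s1 s2.
      have xs : x <= s by apply: le_trans s1; rewrite le_min y1.
      have sx : s < x + r by apply: le_lt_trans s2 _; rewrite gt_max y2.
      by rewrite ger0_norm; lra.
    have := ler_normB (g y) (g y0).
    have [/= g1 _] := Sy; have [/= g2 _] := Sy0 => g3 g4.
    by rewrite in_itv/= -ler_distl ler_pdivlMr// mulrC; lra.
  rewrite lebesgue_measure_itv/= lte_fin.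
  have tr : 0 < 2 * t / r by rewrite divr_gt0// mulr_gt0.
  rewrite ifT; last by lra.
  rewrite -EFinB lee_fin (_ : C * t = 2 * t + 2 * (2 * t / r)); first lra.
  by rewrite /C; ring.
(* The K intervals of length r starting at the multiples of r cover [0, 1[. *)
pose K := (Num.trunc r^-1).+1.
exists (K%:R * C); first by rewrite mulr_gt0// ltr0n.
move=> t t0.
apply: (@le_trans _ _ (lebesgue_measure
   (\big[setU/set0]_(k < K) S t (k%:R * r) : set R))).
  rewrite le_measure ?inE//; first by apply: measurableI => //; exact: sublevel_measurable.
    by apply: bigsetU_measurable => k _; exact: mS.
  move=> x [xt]; rewrite /= in_itv/= => /andP[x0 x1].
  have xr0 : 0 <= x / r by rewrite divr_ge0// ltW.
  have /andP[k1 k2] := truncn_itv xr0.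
  have kK : (Num.trunc (x / r) < K)%N.
    rewrite ltnS; apply: le_truncn; rewrite -[leRHS]mul1r ler_wpM2r ?invr_ge0// ltW//.
  rewrite -(bigcup_mkord K (fun k => S t (k%:R * r))).
  exists (Num.trunc (x / r)) => //; split => //=; rewrite in_itv/=.
  rewrite ler_pdivlMr// in k1; rewrite k1/=.
  by move: k2; rewrite ltr_pdivrMr// -natr1 mulrDl mul1r.
apply: le_trans (@Boole_inequality _ _ _ (@lebesgue_measure R)
  (fun k => S t (k%:R * r)) K (fun k _ => mS _ _)) _.
apply: (@le_trans _ _ (\sum_(k < K) (C * t)%:E)%E).
  apply: lee_sum => k _; apply: loc => //; rewrite mulr_ge0 ?(ltW r0)//=.
  rewrite -ler_pdivlMr// div1r; have := ltn_ord k; rewrite ltnS => kr.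
  apply: (@le_trans _ _ (Num.trunc r^-1)%:R); first by rewrite ler_nat.
  by rewrite truncn_le invr_ge0 ltW.
by rewrite sumEFin lee_fin sumr_const card_ord -[leLHS]mulr_natl mulrA.
Qed.
End c1_function.

(** * The uniform law on the torus *)

Definition circle_prob (R : realType) : probability (measurableTypeR R) R :=
  uniform_prob (@ltr01 R).

Definition torus_prob (R : realType) :
    probability (measurableTypeR R * measurableTypeR R)%type R :=
  (circle_prob R \x circle_prob R)%E.

Lemma circle_probE (R : realType) (A : set R) : measurable A ->
  circle_prob R A = lebesgue_measure (A `&` `[0, 1[).
Proof. by move=> mA; rewrite [LHS]uniform_probE// subr0 invr1 mul1e. Qed.

Definition periodic_set (R : realType) (D : set (R * R)) : Prop :=
  forall (x y : R) (k l : int), D (x, y) -> D (x + k%:~R, y + l%:~R).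

Lemma torus_prob_swap (R : realType) (A : set (R * R)) :
  measurable A ->
  torus_prob R A = (\int[circle_prob R]_y circle_prob R [set x | A (x, y)])%E.
Proof.
move=> mA; have -> : torus_prob R A = (circle_prob R \x^ circle_prob R)%E A.
  by apply: product_measure_unique => //= *; rewrite product_measure2E.
by apply: eq_integral => y _ /=; rewrite ysectionE.
Qed.

Lemma measurable_setpair1 (R : realType) (D : set (R * R)) (y : R) :
  measurable D -> measurable [set x | D (x, y)].
Proof. by move=> /(@measurable_ysection _ _ _ _ _ y); rewrite ysectionE. Qed.

Lemma torus_prob_translate (R : realType) (w : R) (D : set (R * R)) :
  measurable D -> periodic_set D ->
  torus_prob R [set z | D (z.1 + w, z.2)] = torus_prob R D.
Proof.
move=> mD perD.
have mT : measurable [set z : R * R | D (z.1 + w, z.2)].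
  rewrite -[X in measurable X]setTI.
  by apply: (measurable_fun_pair (f := fun z : R * R => z.1 + w) (g := snd)) => //;
    exact: measurable_funD.
rewrite !torus_prob_swap//; apply: eq_integral => y _ /=.
have mDy := measurable_setpair1 y mD.
have mDyw := measurable_shift w mDy.
rewrite !circle_probE//; apply: (lebesgue_periodic_shift w mDy) => x k /=.
by move=> /(perD _ _ k 0); rewrite addr0.
Qed.

Lemma measurable_step (R : realType) (f : R -> R) (w : R) (D : set (R * R)) :
  measurable_fun setT f -> measurable D ->
  measurable [set z : R * R | D (f z.1 - z.2 + w, z.1)].
Proof.
move=> mf mD; rewrite -[X in measurable X]setTI.
apply: (measurable_fun_pair (f := fun z : R * R => f z.1 - z.2 + w) (g := fst)) => //.
apply: measurable_funD => //; apply: measurable_funB => //.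
exact: measurableT_comp.
Qed.

Lemma torus_prob_step (R : realType) (f : R -> R) (w : R) (D : set (R * R)) :
  measurable_fun setT f -> measurable D -> periodic_set D ->
  torus_prob R [set z | D (f z.1 - z.2 + w, z.1)] = torus_prob R D.
Proof.
move=> mf mD perD.
have mT := measurable_step w mf mD.
rewrite [RHS]torus_prob_swap//; apply: eq_integral => x _ /=.
rewrite xsectionE /=.
have mDx := measurable_setpair1 x mD.
have mDr : measurable [set y | D (f x - y + w, x)].
  by have := measurable_xsection x mT; rewrite xsectionE.
rewrite !circle_probE//.
rewrite -(@lebesgue_periodic_reflect _ (f x + w) _ mDx); last first.
  by move=> y k /= /(perD _ _ k 0); rewrite addr0.
by congr (lebesgue_measure (_ `&` _)); apply: eq_set => y; rewrite addrAC.
Qed.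

(** Area preservation, iterated: with the noise fixed, each step reflects and
    translates the second coordinate by an amount that depends on the first one,
    then exchanges both. *)
Lemma torus_prob_noisy (R : realType) (f : R -> R) (omega : nat -> R) n
    (D : set (R * R)) :
  measurable_fun setT f -> periodic f 1 -> measurable D -> periodic_set D ->
  torus_prob R [set z | D (noisy f omega z n)] = torus_prob R D.
Proof.
move=> mf perf; elim: n D => [|n IHn] D mD perD.
  exact: (torus_prob_translate (omega 0%N) mD perD).
rewrite -(torus_prob_step (omega n.+1) mf mD perD).
apply: (IHn [set z | D (f z.1 - z.2 + omega n.+1, z.1)]).
  exact: (measurable_step (omega n.+1) mf mD).
move=> x y k l /=; rewrite (periodic_int k x perf).
move=> /(perD _ _ (- l) k); rewrite rmorphN/=.
by rewrite (_ : f x - y + _ + - _ = f x - (y + l%:~R) + omega n.+1)//; ring.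
Qed.

Lemma torus_probX (R : realType) (A B : set R) : measurable A -> measurable B ->
  torus_prob R (A `*` B) = (circle_prob R A * circle_prob R B)%E.
Proof. by move=> mA mB; rewrite [LHS]product_measure1E. Qed.

(** Cut the range of |h(x)| into the layers B / q^(m+1) < |h(x)| <= B / q^m.  In
    each layer the sublevel bound is applied to both factors, with a loss of a
    factor q; what lies below the last layer is bounded with the first factor
    alone.  A logarithm is thus traded for the number J of layers. *)
Lemma torus_prob_small_product (R : realType) (h : R -> R) (B C q tau : R)
    (J : nat) :
  measurable_fun setT h -> 0 < B -> 0 <= C -> 0 < q -> 0 < tau ->
  (forall x, `|h x| <= B) ->
  (forall t : R, 0 < t -> (circle_prob R [set x | (`|h x| <= t)%R] <= (C * t)%:E)%E) ->
  (torus_prob R [set z | (`|h z.1 * h z.2| <= tau)%R] <=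
    (J%:R * (C ^+ 2 * q * tau) + C * (B / q ^+ J))%:E)%E.
Proof.
move=> mh B0 C0 q0 tau0 hB hC.
pose A (t : R) := [set x | `|h x| <= t].
have mA t : measurable (A t).
  by apply: measurable_boolset; apply: measurable_fun_ler => //; exact: measurableT_comp.
pose t (m : nat) := B / q ^+ m.
have t0 m : 0 < t m by rewrite divr_gt0// exprn_gt0.
have sub : [set z : R * R | `|h z.1 * h z.2| <= tau] `<=`
    \big[setU/set0]_(m < J) (A (t m) `*` A (tau / t m.+1)) `|` (A (t J) `*` setT).
  move=> [x y] /=; rewrite normrM => xy.
  elim: J => [|J IHJ].
    by right; split => //; rewrite /A/= /t expr0 divr1.
  rewrite big_ord_recr/=; case: IHJ => [H|[xJ _]]; first by left; left.
  have [xS|xS] := leP `|h x| (t J.+1); first by right.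
  left; right; split => //; rewrite /A/= ler_pdivlMr// mulrC.
  by apply: le_trans xy; rewrite ler_wpM2r// ltW.
have mX m : measurable (A (t m) `*` A (tau / t m.+1)) by exact: measurableX.
have mU : measurable (\big[setU/set0]_(m < J) (A (t m) `*` A (tau / t m.+1))).
  by apply: bigsetU_measurable => m _; exact: mX.
have mJ : measurable (A (t J) `*` [set: R]) by exact: measurableX.
apply: (le_trans (le_measure (torus_prob R) _ _ sub)); rewrite ?inE.
- apply: measurable_boolset; apply: measurable_fun_ler => //.
  apply: measurableT_comp => //; apply: measurable_funM; exact: measurableT_comp.
- exact: measurableU.
apply: le_trans (@measureU2 _ _ _ (torus_prob R) _ _ mU mJ) _.
rewrite EFinD; apply: leeD; last first.
  by rewrite [leLHS]torus_probX// probability_setT mule1; exact: hC.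
apply: le_trans (@Boole_inequality _ _ _ (torus_prob R)
  (fun m => A (t m) `*` A (tau / t m.+1)) J (fun m _ => mX m)) _.
apply: (@le_trans _ _ (\sum_(m < J) (C ^+ 2 * q * tau)%:E)%E); last first.
  by rewrite sumEFin lee_fin sumr_const card_ord -[leLHS]mulr_natl.
apply: lee_sum => m _; rewrite [leLHS](torus_probX (mA _) (mA _)).
have tt0 : 0 < tau / t m.+1 by rewrite divr_gt0.
apply: le_trans (lee_pmul _ _ (hC _ (t0 m)) (hC _ tt0)) _ => //.
rewrite -EFinM lee_fin /t exprS le_eqVlt; apply/orP; left; apply/eqP.
by field; rewrite !gt_eqF// exprn_gt0.
Qed.

(** * Slow vectors for a fixed initial point *)

(** This replaces an average over a continuous parameter, and so avoids any
    measurability in that parameter. *)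
Lemma disjoint_copies_measure d (T : measurableType d) (R : realType)
    (P : probability T R) (A : set T) (F : nat -> set T) (M : nat) (b : R) :
  (0 < M)%N -> measurable A -> (forall m, (m < M)%N -> measurable (F m)) ->
  trivIset `I_M F ->
  (forall m, (m < M)%N -> P A <= P (F m) + b%:E)%E ->
  (P A <= (M%:R^-1 + b)%:E)%E.
Proof.
move=> M0 mA mF tF PA.
have fP B : measurable B -> P B \is a fin_num by exact: fin_num_measure.
have mU : measurable (\big[setU/set0]_(m < M) F m).
  by apply: bigsetU_measurable => m _; exact: mF.
have S1 : (\sum_(m < M) P (F m) <= 1)%E.
  by rewrite -measure_semi_additive_ord_I// probability_le1.
have fS : \sum_(m < M) fine (P (F m)) <= 1.
  rewrite -lee_fin -sumEFin; apply: le_trans S1; apply: lee_sum => m _.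
  by rewrite fineK// fP//; exact: mF.
have fA m : (m < M)%N -> fine (P A) <= fine (P (F m)) + b.
  by move=> mM; rewrite -lee_fin EFinD !fineK ?fP ?PA//; exact: mF.
rewrite -[leLHS]fineK ?fP// lee_fin -lerBlDr.
have M0' : 0 < M%:R :> R by rewrite ltr0n.
rewrite -(ler_pM2l M0') mulfV ?gt_eqF//; apply: le_trans fS.
rewrite mulr_natl -[M in X in X <= _]card_ord -sumr_const; apply: ler_sum => m _.
by rewrite lerBlDr fA.
Qed.

Definition slope (R : realType) (df f : R -> R) (omega : nat -> R) (z : R * R)
  (n : nat) : R := df (noisy f omega z n).1.

Definition slow (R : realType) (K : R) (df f : R -> R) (omega : nat -> R)
    (z : R * R) (n : nat) : bool :=
  let t := tangent (slope df f omega z) (1, 0) n in `|t.1| < K * `|t.2|.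

(** The window starts at time a + 1: the slope at time a is the one that the
    kick modifies, so no condition may bear on it. *)
Definition expanding (R : realType) (K theta : R) (df f : R -> R)
    (omega : nat -> R) (z : R * R) (a N : nat) : Prop :=
  (forall m, (m < N.*2)%N -> theta <=
    `|slope df f omega z (a.+1 + m.+1) * slope df f omega z (a.+1 + m)|) /\
  4 * K <= `|slope df f omega z (a.+1 + N.*2)|.

Section measurability.
Context d (T : measurableType d) (R : realType) (df f : R -> R).
Variables (omega : T -> noise R) (z : T -> R * R).
Hypotheses (mf : measurable_fun setT f) (mdf : measurable_fun setT df).
Hypotheses (mo : measurable_fun setT omega)
  (m1 : measurable_fun setT (fun t => (z t).1))
  (m2 : measurable_fun setT (fun t => (z t).2)).

Lemma measurable_slope n :
  measurable_fun setT (fun t => slope df f (omega t) (z t) n).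
Proof. exact: (measurableT_comp mdf (measurable_noisy n mf mo m1 m2).1). Qed.

Lemma measurable_slow K n :
  measurable [set t | slow K df f (omega t) (z t) n].
Proof.
have [t1 t2] := measurable_tangent (1, 0) n measurable_slope.
apply: measurable_boolset; apply: measurable_fun_ltr.
  exact: measurableT_comp.
by apply: measurable_funM => //; exact: measurableT_comp.
Qed.

Lemma measurable_expanding K theta a N :
  measurable [set t | expanding K theta df f (omega t) (z t) a N].
Proof.
rewrite (_ : [set t | _] = (\bigcap_(m in `I_(N.*2)) [set t | theta <=
    `|slope df f (omega t) (z t) (a.+1 + m.+1) *
      slope df f (omega t) (z t) (a.+1 + m)|]) `&`
    [set t | 4 * K <= `|slope df f (omega t) (z t) (a.+1 + N.*2)|]); last first.
  by apply/seteqP; split.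
apply: measurableI; last first.
  apply: measurable_boolset; apply: measurable_fun_ler => //.
  by apply: measurableT_comp => //; exact: measurable_slope.
apply: bigcap_measurableType => m _.
apply: measurable_boolset; apply: measurable_fun_ler => //.
by apply: measurableT_comp => //; apply: measurable_funM; exact: measurable_slope.
Qed.

End measurability.

(** Kicks of size s m, for m < M, only modify the slope at time a.  A noise that
    belonged to two of the kicked copies of the event would give two values of
    this slope for which the vector is slow, against [tangent_slow_unique]. *)
Lemma slow_noise_measure (R : realType) (eps : R) (eps0 : 0 < eps)
    (P : probability (noise R) R) (df f : R -> R) (rho : set R) (z : R * R)
    (K theta s D : R) (a N M : nat) :
  is_noise_law eps0 P ->
  measurable_fun setT f -> measurable_fun setT df -> measurable rho ->
  0 < K -> 4 <= theta -> (0 < N)%N -> (0 < M)%N -> 0 < s ->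
  (forall x m, (m < M)%N -> `|f x - f (x + s *+ m)| <= D) ->
  (forall x m m', (m < M)%N -> (m' < M)%N -> m != m' -> rho (x + s *+ m) ->
    2 < `|df (x + s *+ m) - df (x + s *+ m')| * (K * ((theta / 4) ^+ N) ^+ 2)) ->
  (P [set omega : noise R | [/\ expanding K theta df f omega z a N,
       rho (noisy f omega z a).1 & slow K df f omega z (a.+1 + N.*2.+1)]] <=
   (M%:R^-1 + (2 * s *+ M + D) / (2 * eps))%:E)%E.
Proof.
move=> lawP mf mdf mrho K0 theta4 N0 M0 s0 fD sep.
set A := [set omega : noise R | _].
have mcoord : measurable_fun setT (id : noise R -> noise R) by [].
have mz1 : measurable_fun [set: noise R] (fun=> z.1) by [].
have mz2 : measurable_fun [set: noise R] (fun=> z.2) by [].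
have mX n : measurable_fun setT (fun omega : noise R => (noisy f omega z n).1).
  by have [] := measurable_noisy n mf mcoord mz1 mz2.
have mA : measurable A.
  rewrite (_ : A = [set omega : noise R | expanding K theta df f omega z a N] `&`
    ([set omega : noise R | rho (noisy f omega z a).1] `&`
     [set omega : noise R | slow K df f omega z (a.+1 + N.*2.+1)])); last first.
    by apply/seteqP; split=> omega [] // ? [].
  apply: measurableI; first exact: (@measurable_expanding _ _ _ df f id (fun=> z)).
  apply: measurableI; last exact: (@measurable_slow _ _ _ df f id (fun=> z)).
  by rewrite -[X in measurable X]setTI; exact: mX.
have mkick delta : measurable_fun setT (noise_kick f z a delta : noise R -> noise R).
  have mc k : measurable_fun setT (fun omega : noise R => omega k : R).
    exact: measurable_noise_coord.
  apply: measurable_noise_set; first by apply: measurable_funD.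
  apply: measurable_noise_set; last first.
    by apply: measurable_noise_set => //; apply: measurable_funD.
  apply: measurable_funD => //; apply: measurable_funB.
    exact: measurableT_comp.
  by apply: (measurableT_comp mf); exact: measurable_funD.
pose F m := [set omega : noise R | A (noise_kick f z a (s *+ m) omega)].
apply: (disjoint_copies_measure (F := F)) => //.
- by move=> m _; rewrite -[X in measurable X]setTI; exact: mkick.
- apply/trivIsetP => m m' /= mM mM' mm'; apply/seteqP; split => // omega /=.
  have slopeE k n : slope df f (noise_kick f z a (s *+ k) omega) z n =
      df ((noisy f omega z n).1 + s *+ k *+ (n == a)).
    by rewrite /slope noisy_kick.
  have slopeN k n : n != a ->
      slope df f (noise_kick f z a (s *+ k) omega) z n = slope df f omega z n.
    by move=> /negbTE na; rewrite slopeE na addr0.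
  pose v n := slope df f omega z (a.+1 + n).
  pose t := tangent (slope df f omega z) (1, 0) a.
  have tE k : tangent (slope df f (noise_kick f z a (s *+ k) omega) z) (1, 0)
      (a.+1 + N.*2.+1) =
      tangent v (df ((noisy f omega z a).1 + s *+ k) * t.1 - t.2, t.1) N.*2.+1.
    rewrite tangentD (@eq_tangent _ _ v); last first.
      by move=> n _; rewrite slopeN//; apply/eqP; lia.
    congr (tangent _ _ _); rewrite /= slopeE eqxx mulr1n.
    by rewrite (@eq_tangent _ _ (slope df f omega z)) // => n na; rewrite slopeN// ltn_eqF.
  rewrite /F /A /= /slow !tE => -[[[vv vK] rhom slowm] [_ _ slowm']].
  have {}vv n : (n < N.*2)%N -> theta <= `|v n.+1 * v n|.
    by move=> /vv; rewrite !slopeN//; apply/eqP; lia.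
  rewrite slopeN in vK; last by apply/eqP; lia.
  have v0 : v 0%N != 0.
    have := vv 0%N; rewrite double_gt0 N0 => /(_ isT); apply: contraTneq => ->.
    by rewrite mulr0 normr0 -ltNge; lra.
  have := tangent_growth theta4 vv v0; cbv zeta; set w := tangent v (1, 0) _ => -[w1 w2].
  have th1 : 0 < (theta / 4) ^+ N by rewrite exprn_gt0// divr_gt0//; lra.
  have w2_gt0 : 0 < `|w.2| by exact: lt_le_trans w2.
  have w12 : 2 * K * `|w.2| <= `|w.1|.
    by apply: le_trans w1; rewrite ler_pM2r// ler_pdivlMr//; apply: le_trans vK; lra.
  have w0 : w.2 != 0 by rewrite -normr_gt0.
  have := tangent_slow_unique K0 w12 w0 slowm slowm'.
  rewrite leNgt => /negP; apply.
  apply: lt_le_trans (sep (noisy f omega z a).1 m m' mM mM' mm' _) _.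
    by have := noisy_kick f z a (s *+ m) omega a; rewrite eqxx mulr1n => <-.
  by rewrite ler_wpM2l// ler_pM2l// ler_sqr ?nnegrE ?(ltW th1).
- move=> m mM; apply: le_trans (@noise_law_kick _ _ eps0 P f z a (s *+ m) D A lawP mf _ mA) _.
    by move=> x; exact: fD.
  rewrite leeD2l// lee_fin ler_wpM2r ?invr_ge0 ?mulr_ge0// ?(ltW eps0)//.
  rewrite lerD2r -mulrnAr ler_pM2l// ger0_norm ?mulrn_wge0 ?(ltW s0)//.
  by rewrite ler_wpMn2l ?(ltW s0)// ltnW.
Qed.

(** * Slow vectors for a uniform initial point *)

Definition phase_prob (R : realType) (P : probability (noise R) R) :
    probability ((measurableTypeR R * measurableTypeR R) * noise R)%type R :=
  (torus_prob R \x P)%E.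

Lemma phase_prob_fst_le (R : realType) (P : probability (noise R) R)
    (A : set ((R * R) * noise R)) (p : R) :
  measurable A -> (forall z, P [set omega | A (z, omega)] <= p%:E)%E ->
  (phase_prob P A <= p%:E)%E.
Proof.
move=> mA Ap; apply: (@le_trans _ _ (\int[torus_prob R]_z p%:E)%E).
  apply: ge0_le_integral => //.
  - exact: measurable_fun_xsection.
  - by move=> z _ /=; rewrite xsectionE; exact: Ap.
by rewrite integral_cst// [X in (_ * X)%E]probability_setT mule1.
Qed.

Lemma phase_prob_snd_le (R : realType) (P : probability (noise R) R)
    (A : set ((R * R) * noise R)) (p : R) :
  measurable A ->
  (forall omega, torus_prob R [set z | A (z, omega)] <= p%:E)%E ->
  (phase_prob P A <= p%:E)%E.
Proof.
move=> mA Ap; have -> : phase_prob P A = (torus_prob R \x^ P)%E A.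
  by apply: product_measure_unique => // B C mB mC; exact: product_measure2E.
apply: (@le_trans _ _ (\int[P]_omega p%:E)%E).
  apply: ge0_le_integral => //.
  - exact: measurable_fun_ysection.
  - by move=> omega _ /=; rewrite ysectionE; exact: Ap.
by rewrite integral_cst// [X in (_ * X)%E]probability_setT mule1.
Qed.

Lemma measurable_initial_point (R : realType) :
  measurable_fun setT (fun x : (R * R) * noise R => x.1.1) /\
  measurable_fun setT (fun x : (R * R) * noise R => x.1.2).
Proof.
split; first exact: (measurableT_comp measurable_fst measurable_fst).
exact: (measurableT_comp measurable_snd measurable_fst).
Qed.

Lemma phase_prob_noisy_le (R : realType) (P : probability (noise R) R)
    (f : R -> R) n (D : set (R * R)) (p : R) :
  measurable_fun setT f -> periodic f 1 -> measurable D -> periodic_set D ->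
  (torus_prob R D <= p%:E)%E ->
  (phase_prob P [set x | D (noisy f x.2 x.1 n)] <= p%:E)%E.
Proof.
move=> mf perf mD perD Dp; apply: phase_prob_snd_le => /=.
  have [m11 m12] := measurable_initial_point R.
  have [mX mY] := measurable_noisy n mf (@measurable_snd _ _ (R * R)%type (noise R)) m11 m12.
  rewrite -[X in measurable X]setTI.
  have := measurable_fun_pair mX mY => /(_ measurableT D mD).
  by congr (measurable (_ `&` _)); apply: eq_set => x /=; case: (noisy _ _ _ _).
by move=> omega; rewrite torus_prob_noisy.
Qed.

(** Outside an expanding window or outside [rho], stationarity of the orbit for a
    fixed noise gives the bound; inside, [slow_noise_measure] gives it for every
    fixed initial point. *)
Lemma slow_measure (R : realType) (eps : R) (eps0 : 0 < eps)
    (P : probability (noise R) R) (df f : R -> R) (rho : set R)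
    (K theta s D p1 p2 p3 : R) (a N M : nat) :
  is_noise_law eps0 P ->
  measurable_fun setT f -> measurable_fun setT df -> measurable rho ->
  periodic f 1 -> periodic df 1 -> (forall x (k : int), rho (x + k%:~R) -> rho x) ->
  0 < K -> 4 <= theta -> (0 < N)%N -> (0 < M)%N -> 0 < s ->
  (forall x m, (m < M)%N -> `|f x - f (x + s *+ m)| <= D) ->
  (forall x m m', (m < M)%N -> (m' < M)%N -> m != m' -> rho (x + s *+ m) ->
    2 < `|df (x + s *+ m) - df (x + s *+ m')| * (K * ((theta / 4) ^+ N) ^+ 2)) ->
  (torus_prob R [set z | (`|df z.1 * df z.2| <= theta)%R] <= p1%:E)%E ->
  (circle_prob R [set x | (`|df x| <= 4 * K)%R] <= p2%:E)%E ->
  (circle_prob R (~` rho) <= p3%:E)%E ->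
  (phase_prob P [set x | slow K df f x.2 x.1 (a.+1 + N.*2.+1)] <=
   (M%:R^-1 + (2 * s *+ M + D) / (2 * eps) + (p1 *+ N.*2 + p2 + p3))%:E)%E.
Proof.
move=> lawP mf mdf mrho perf perdf perrho K0 theta4 N0 M0 s0 fD sep hp1 hp2 hp3.
pose X n (x : (R * R) * noise R) := noisy f x.2 x.1 n.
have [m11 m12] := measurable_initial_point R.
have m2 := @measurable_snd _ _ (R * R)%type (noise R).
have mX n := (measurable_noisy n mf m2 m11 m12).1.
pose S := [set x : (R * R) * noise R | slow K df f x.2 x.1 (a.+1 + N.*2.+1)].
have mS : measurable S by exact: (measurable_slow mf mdf m2 m11 m12).
pose E := [set x : (R * R) * noise R | expanding K theta df f x.2 x.1 a N].
have mE : measurable E by exact: (measurable_expanding mf mdf m2 m11 m12).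
pose Q := [set x : (R * R) * noise R | rho (X a x).1].
have mQ : measurable Q.
  by rewrite -[X in measurable X]setTI; exact: mX.
pose D1 := [set z : R * R | `|df z.1 * df z.2| <= theta].
have mdf1 : measurable_fun setT (fun z : R * R => df z.1) by exact: measurableT_comp.
have mdf2 : measurable_fun setT (fun z : R * R => df z.2) by exact: measurableT_comp.
have mD1 : measurable D1.
  apply: measurable_boolset; apply: measurable_fun_ler => //.
  by apply: measurableT_comp => //; exact: measurable_funM.
have perD1 : periodic_set D1.
  by move=> x y k l; rewrite /D1/= !(periodic_int _ _ perdf).
pose D2 := [set x : R | `|df x| <= 4 * K].
have mD2 : measurable D2.
  by apply: measurable_boolset; apply: measurable_fun_ler => //; exact: measurableT_comp.
pose Z1 n := [set x | D1 (X n x)].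
have mZ (D' : set (R * R)) n : measurable D' -> measurable [set x | D' (X n x)].
  move=> mD'; have [m1' m2'] := measurable_noisy n mf m2 m11 m12.
  rewrite -[X in measurable X]setTI.
  have := measurable_fun_pair m1' m2' => /(_ measurableT D' mD').
  by congr (measurable (_ `&` _)); apply: eq_set => x /=; rewrite /X; case: (noisy _ _ _ _).
have Z1p n : (phase_prob P (Z1 n) <= p1%:E)%E by exact: phase_prob_noisy_le.
pose Z2 := [set x | (D2 `*` setT) (X (a.+1 + N.*2)%N x)].
have Z2p : (phase_prob P Z2 <= p2%:E)%E.
  apply: phase_prob_noisy_le => //; first exact: measurableX.
    by move=> x y k l [/= H _]; split => //=; rewrite /D2/= (periodic_int _ _ perdf).
  by rewrite [leLHS]torus_probX// [X in (_ * X)%E]probability_setT mule1.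
pose Z3 := [set x | (~` rho `*` setT) (X a x)].
have Z3p : (phase_prob P Z3 <= p3%:E)%E.
  apply: phase_prob_noisy_le => //.
  - by apply: measurableX => //; exact: measurableC.
  - by move=> x y k l [/= H _]; split => //= /perrho.
  - by rewrite [leLHS]torus_probX ?[X in (_ * X)%E]probability_setT ?mule1//; exact: measurableC.
pose U1 := \big[setU/set0]_(m < N.*2) Z1 (a.+1 + m.+1)%N.
have mU1 : measurable U1 by apply: bigsetU_measurable => m _; exact: mZ.
have mZ2 : measurable Z2 by apply: mZ; exact: measurableX.
have mZ3 : measurable Z3 by apply: mZ; apply: measurableX => //; exact: measurableC.
have cover : S `<=` (E `&` (Q `&` S)) `|` (U1 `|` (Z2 `|` Z3)).
  move=> x Sx; have [Qx|nQx] := pselect (Q x); last by right; right; right.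
  have [Ex|nEx] := pselect (E x); first by left.
  right; have [Z2x|nZ2x] := pselect (Z2 x); first by right; left.
  left; rewrite /U1 -(bigcup_mkord N.*2 (fun m => Z1 (a.+1 + m.+1)%N)).
  apply: contrapT => nU1; apply: nEx; split => [m mN|].
    rewrite leNgt; apply/negP => H; apply: nU1; exists m => //.
    by apply: ltW; move: H; rewrite /slope addnS noisyS.
  by rewrite leNgt; apply/negP => H; apply: nZ2x; split => //; exact: ltW.
have mES := measurableI _ _ mE (measurableI _ _ mQ mS).
have mZ23 : measurable (Z2 `|` Z3) by exact: measurableU.
have mU : measurable (U1 `|` (Z2 `|` Z3)) by exact: measurableU.
have mEU := measurableU _ _ mES mU.
apply: le_trans (le_measure (phase_prob P) (mem_set mS) (mem_set mEU) cover) _.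
apply: le_trans (@measureU2 _ _ _ (phase_prob P) _ _ mES mU) _.
rewrite EFinD; apply: leeD.
  apply: phase_prob_fst_le => // z.
  apply: le_trans _ (slow_noise_measure z a lawP mf mdf mrho K0 theta4 N0 M0 s0 fD sep).
  by rewrite le_eqVlt; apply/orP; left; apply/eqP; congr (P _);
    apply/seteqP; split=> omega /= => [[? []]|[]].
apply: le_trans (@measureU2 _ _ _ (phase_prob P) _ _ mU1 mZ23) _.
rewrite (_ : p1 *+ N.*2 + p2 + p3 = p1 *+ N.*2 + (p2 + p3)); last by rewrite addrA.
rewrite EFinD; apply: leeD; last first.
  apply: le_trans (@measureU2 _ _ _ (phase_prob P) _ _ mZ2 mZ3) _.
  by rewrite EFinD; apply: leeD.
apply: le_trans (@Boole_inequality _ _ _ (phase_prob P)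
  (fun m => Z1 (a.+1 + m.+1)%N) N.*2 (fun m _ => mZ _ _ mD1)) _.
apply: (@le_trans _ _ (\sum_(m < N.*2) p1%:E)%E); first by apply: lee_sum => m _; exact: Z1p.
by rewrite sumEFin sumr_const card_ord.
Qed.

(** * Differentials and the growth of tangent vectors *)

Section differential.
Variables (R : realType) (f df : R -> R) (omega : nat -> R) (z : R * R).
Hypothesis fdf : forall x : R, is_derive x (1 : R) f (df x).

Lemma is_diff_torusFn n :
  is_diff z (torusFn f omega n) (fun e => tangent (slope df f omega z) e n).
Proof.
have dfst : is_diff z (fst : R * R -> R) fst.
  apply: DiffDef; first by apply: linear_differentiable => x; exact: cvg_fst.
  by rewrite diff_lin// => x; exact: cvg_fst.
have dsnd : is_diff z (snd : R * R -> R) snd.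
  apply: DiffDef; first by apply: linear_differentiable => x; exact: cvg_snd.
  by rewrite diff_lin// => x; exact: cvg_snd.
have dpair (g dg : R * R -> R * R) : is_diff z (fst \o g) (fst \o dg) ->
    is_diff z (snd \o g) (snd \o dg) -> is_diff z g dg.
  move=> h1 h2; have := is_diff_pair h1 h2.
  by congr (is_diff _ _ _); apply/funext => y /=; case: (_ y).
suff [h1 h2] : is_diff z (fst \o torusFn f omega n)
    (fun e => (tangent (slope df f omega z) e n).1) /\
  is_diff z (snd \o torusFn f omega n)
    (fun e => (tangent (slope df f omega z) e n).2) by exact: dpair.
elim: n => [|n [IH1 IH2]]; first by split.
have d1 : is_diff z (fun y => (torusFn f omega n y).1 + omega n)
    (fun e => (tangent (slope df f omega z) e n).1).
  have := is_diffD IH1 (is_diff_cst (omega n) z).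
  by rewrite addr0.
split; last exact: d1.
have dfx : is_diff ((torusFn f omega n z).1 + omega n) f
    (fun h => h * slope df f omega z n).
  have [/derivable1_diffP fx fv] := fdf ((torusFn f omega n z).1 + omega n).
  apply: DiffDef => //; rewrite diff1E// derive1E fv.
  by apply/funext => h.
have := is_diffB (is_diff_comp d1 dfx) IH2.
by congr (is_diff _ _ _); apply/funext => e /=; rewrite mulrC.
Qed.
End differential.

Lemma enorm_ge (R : realType) (e : R * R) : Num.max `|e.1| `|e.2| <= enorm e.
Proof.
rewrite /enorm ge_max -!sqrtr_sqr !ler_wsqrtr// ?lerDl ?lerDr ?sqr_ge0//.
Qed.

Lemma enorm_le (R : realType) (e : R * R) : enorm e <= `|e.1| + `|e.2|.
Proof.
rewrite /enorm -(ger0_norm (addr_ge0 (normr_ge0 e.1) (normr_ge0 e.2))) -sqrtr_sqr.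
rewrite ler_wsqrtr// sqrrD !real_normK ?num_real// -addrA lerD2l lerDr.
by rewrite mulrn_wge0// mulr_ge0.
Qed.

Lemma tangent_bounded (R : realType) (v : nat -> R) n : exists c : R,
  forall e, `|e.1| <= 1 -> `|e.2| <= 1 ->
    `|(tangent v e n).1| <= c /\ `|(tangent v e n).2| <= c.
Proof.
elim: n => [|n [c IHn]]; first by exists 1.
exists (`|v n| * `|c| + `|c|) => e e1 e2; have [h1 h2] := IHn e e1 e2.
have cc : c <= `|c| := ler_norm c.
have h3 : 0 <= `|v n| * `|c| by rewrite mulr_ge0.
split => /=; last by lra.
apply: le_trans (ler_normB _ _) _; apply: lerD; last by lra.
by rewrite normrM ler_wpM2l//; lra.
Qed.

(** A supremum is only an upper bound for a bounded set, hence
    [tangent_bounded]. *)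
Lemma opnorm_tangent (R : realType) (v : nat -> R) n :
  enorm (tangent v (1, 0) n) <= opnorm (fun e => tangent v e n).
Proof.
apply: ub_le_sup.
  have [c hc] := tangent_bounded v n; exists (c + c) => _ [e /= e1 <-].
  have := le_trans (enorm_ge e) e1; rewrite ge_max => /andP[e11 e12].
  have [h1 h2] := hc e e11 e12.
  by apply: le_trans (enorm_le _) _; exact: lerD.
exists (1, 0) => //=; rewrite /enorm /= expr1n expr0n addr0.
by rewrite sqrtr1.
Qed.

(** Each slow time spoils two steps, the one that reaches it and the one that
    leaves it; a spoiled step costs the missing factor K and a possible
    contraction by B + 1.  In the induction, the cost of the second step is paid
    in advance, which is the factor [La] in the strengthened statement. *)
Lemma tangent_growth_count (R : realType) (v : nat -> R) (K B : R) n :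
  1 <= K -> 0 <= B -> (forall k, `|v k| <= B) ->
  let t k := tangent v (1, 0) k in
  let s k := `|(t k).1| < K * `|(t k).2| in
  K ^+ n <= Num.max `|(t n).1| `|(t n).2| *
    (K * (B + 1)) ^+ (2 * \sum_(k < n.+1) s k).
Proof.
move=> K1 B0 vB; cbv zeta; pose t k := tangent v (1, 0) k.
pose s k := `|(t k).1| < K * `|(t k).2|; rewrite -/(t n).
rewrite (_ : (\sum_(k < n.+1) _)%N = (\sum_(k < n.+1) s k)%N)//.
set La := K * (B + 1).
pose c n := (\sum_(k < n.+1) s k)%N.
pose m n := Num.max `|(t n).1| `|(t n).2|.
have K0 : 0 < K by lra.
have La1 : 1 <= La by rewrite /La; nra.
have m0 k : 0 <= m k by rewrite le_max normr_ge0.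
have mS k : m k <= (B + 1) * m k.+1.
  have h1 : `|(t k).1| <= m k.+1 by rewrite le_max /= lexx orbT.
  have h2 : `|(t k).2| <= B * m k.+1 + m k.+1.
    rewrite (_ : (t k).2 = v k * (t k).1 - (t k.+1).1); last by rewrite /t/=; ring.
    apply: le_trans (ler_normB _ _) _; rewrite normrM; apply: lerD.
      by apply: ler_pM.
    by rewrite le_max lexx.
  rewrite ge_max; apply/andP; split; have := m0 k.+1; nra.
(* When n is slow, one factor La is kept to pay for the step leaving n. *)
suff : K ^+ n * (if s n then La else 1) <= m n * La ^+ (2 * c n).
  apply: le_trans; rewrite ler_peMr ?exprn_ge0 ?(ltW K0)//.
  by case: ifP.
elim: n => [|n IHn].
  have s0 : s 0%N = false by rewrite /s /= normr0 normr1 mulr0 ltNge ler01.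
  by rewrite s0 /c big_ord_recl big_ord0 s0 /= mulr1 expr0 mulr1 /m /= normr1 le_max lexx.
have cS : c n.+1 = (c n + s n.+1)%N by rewrite /c [LHS]big_ord_recr.
have La2 : 0 <= La ^+ (2 * c n) by rewrite exprn_ge0//; lra.
have Kn : 0 < K ^+ n by rewrite exprn_gt0.
rewrite cS exprS; case sn1 : (s n.+1).
  have h : K ^+ n <= (B + 1) * m n.+1 * La ^+ (2 * c n).
    apply: le_trans (ler_wpM2r La2 (mS n)); apply: le_trans IHn.
    by rewrite ler_peMr ?(ltW Kn)//; case: ifP.
  rewrite mulnDr exprD (_ : m n.+1 * _ = (K * La) *
      ((B + 1) * m n.+1 * La ^+ (2 * c n))); last by rewrite /= /La; ring.
  by rewrite mulrAC ler_pM2l// mulr_gt0//; lra.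
rewrite addn0 mulr1; case sn : (s n) IHn => IHn.
  have := ler_wpM2r La2 (mS n) => h; have {h}IHn := le_trans IHn h.
  have B1 : 0 < B + 1 by lra.
  rewrite -(ler_pM2r B1).
  rewrite (_ : K * K ^+ n * _ = K ^+ n * La); last by rewrite /La; ring.
  by apply: le_trans IHn _; rewrite le_eqVlt; apply/orP; left; apply/eqP; ring.
rewrite mulr1 in IHn.
have mn : m n = `|(t n).1|.
  apply/max_idPl; move/negbT: sn; rewrite /s -leNgt.
  by apply: le_trans; rewrite ler_peMl.
have mn1 : K * m n <= m n.+1.
  move/negbT: sn1; rewrite /s -leNgt [(t n.+1).2]/= -mn => h.
  by apply: le_trans h _; rewrite le_max lexx.
apply: le_trans (ler_wpM2r La2 mn1); by rewrite -mulrA ler_pM2l.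
Qed.

(** * From rare slow vectors to a bound on the exponent *)

Lemma count_measurable d (T : measurableType d) (R : realType)
    (s : nat -> T -> bool) (c : R) n :
  (forall k, measurable [set x | s k x]) ->
  measurable [set x | (\sum_(k < n) s k x)%:R <= c].
Proof.
move=> ms; apply: measurable_boolset; apply: measurable_fun_ler => //.
elim: n => [|n IHn].
  by under eq_fun do rewrite big_ord0; exact: measurable_cst.
under eq_fun do rewrite big_ord_recr natrD.
apply: measurable_funD => //.
rewrite (_ : (fun x => _) = \1_[set x | s n x]); first exact: measurable_indic.
by apply/funext => x; rewrite indicE mem_setE.
Qed.

(** The first i0 times, about which nothing is assumed, are absorbed by taking n
    large. *)
Lemma count_markov d (T : measurableType d) (R : realType)
    (Q : probability T R) (s : nat -> T -> bool) (p : R) (i0 n : nat) :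
  0 < p -> (0 < n)%N -> i0%:R + p <= p * n%:R ->
  (forall k, measurable [set x | s k x]) ->
  (forall k, (i0 <= k)%N -> Q [set x | s k x] <= p%:E)%E ->
  ((2^-1)%:E <= Q [set x | ((\sum_(k < n.+1) s k x)%:R <= 4 * p * n%:R)%R])%E.
Proof.
move=> p0 n0 n_ge ms Qs.
pose S k := [set x | s k x].
pose A := [set x | (\sum_(k < n.+1) s k x)%:R <= 4 * p * n%:R].
have mA : measurable A by exact: count_measurable.
have np0 : 0 < p * n%:R by rewrite mulr_gt0// ltr0n.
have sumS : (\sum_(k < n.+1) Q (S k) <= (2 * (p * n%:R))%:E)%E.
  apply: (@le_trans _ _ (\sum_(k < n.+1) ((k < i0)%N%:R + p)%:E)%E).
    apply: lee_sum => k _; have [ki|ki] := ltnP k i0.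
      apply: le_trans (probability_le1 Q (ms k)) _.
      by rewrite lee_fin lerDl ltW.
    by rewrite add0r; exact: Qs.
  rewrite sumEFin lee_fin big_split /= sumr_const card_ord.
  have : \sum_(i < n.+1) (i < i0)%N%:R <= i0%:R :> R.
    rewrite -natr_sum ler_nat.
    suff -> : (\sum_(i < n.+1) (i < i0) = minn n.+1 i0)%N by exact: geq_minr.
    elim: n.+1 => [|m IHm]; first by rewrite big_ord0 min0n.
    by rewrite big_ord_recr /= IHm; case: ltnP; lia.
  rewrite -[p *+ _]mulr_natr -natr1; lra.
have : ((4 * p * n%:R)%:E * Q (~` A) <= \sum_(k < n.+1) Q (S k))%E.
  have mAC : measurable (~` A) by exact: measurableC.
  have intE (B : set T) : measurable B -> Q B = (\int[Q]_x (\1_B x)%:E)%E.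
    by move=> mB; rewrite integral_indic// setIT.
  have mI (B : set T) : measurable B -> measurable_fun setT (fun x => (\1_B x : R)%:E).
    by move=> mB; apply/measurable_EFinP; exact: measurable_indic.
  under eq_bigr => k _ do rewrite (intE _ (ms k)).
  rewrite intE// -(ge0_integralZl Q measurableT (mI _ mAC))//; last first.
    by rewrite lee_fin; lra.
  rewrite -ge0_integral_sum//; last by move=> k; apply: mI; exact: ms.
  apply: ge0_le_integral => //.
  - by move=> x _; rewrite mule_ge0// lee_fin//; lra.
  - by apply: emeasurable_funM => //; exact: mI.
  - by apply: emeasurable_sum => k; apply: mI; exact: ms.
  move=> x _; rewrite sumEFin -EFinM lee_fin indicE.
  have -> : \sum_(k < n.+1) \1_(S k) x = (\sum_(k < n.+1) s k x)%:R :> R.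
    by rewrite natr_sum; apply: eq_bigr => k _; rewrite indicE mem_setE.
  have [xA|xA] := boolP (x \in ~` A); last by rewrite mulr0.
  by rewrite mulr1 ltW// ltNge; apply/negP; move: xA; rewrite inE.
move=> /le_trans /(_ sumS).
rewrite probability_setC//.
rewrite -[Q A]fineK ?fin_num_measure// -EFinB -EFinM !lee_fin.
set y := fine _ => h.
have : 4 * (p * n%:R) * (1 - y) <= 2 * (p * n%:R) by rewrite mulrA.
by nra.
Qed.

(** If the exponent were smaller, then for each initial point almost every noise
    would belong to finitely many of the events [W n] only, and the upper limit
    of these events would be null although each of them has measure at least
    1/2 eventually. *)
Lemma lambda1_ge (R : realType) (P : probability (noise R) R) (f df : R -> R)
    (K B p lam : R) (i0 : nat) :
  (forall x : R, is_derive x (1 : R) f (df x)) -> measurable_fun setT df ->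
  (forall x, `|df x| <= B) -> 1 <= K -> 0 <= B -> 0 < p ->
  (forall k, (i0 <= k)%N ->
    phase_prob P [set x | slow K df f x.2 x.1 k] <= p%:E)%E ->
  is_lambda1 P f lam ->
  ln K - 8 * p * ln (K * (B + 1)) <= lam.
Proof.
move=> fdf mdf dfB K1 B0 p0 slowp lamP.
have cf : continuous f by exact: is_derive_continuous.
have mf : measurable_fun setT f by exact: continuous_measurable_fun.
set r := ln K - _; rewrite leNgt; apply/negP => lamr.
have La1 : 1 <= K * (B + 1) by nra.
pose s k (x : (R * R) * noise R) := slow K df f x.2 x.1 k.
have [m11 m12] := measurable_initial_point R.
have m2 := @measurable_snd _ _ (R * R)%type (noise R).
have ms k : measurable [set x | s k x] by exact: (measurable_slow mf mdf m2 m11 m12).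
pose W n := [set x | ((\sum_(k < n.+1) s k x)%:R <= 4 * p * n%:R)%R].
have mW n : measurable (W n) by exact: count_measurable.
pose h n (x : (R * R) * noise R) : R :=
  n%:R^-1 * ln (opnorm ('d (torusFn f x.2 n) (x.1))).
have Wh n (x : (R * R) * noise R) : (0 < n)%N -> W n x -> r <= h n x.
  move=> n0 Wx; rewrite /h; have [_ ->] := is_diff_torusFn x.2 x.1 fdf n.
  set v := slope df f x.2 x.1.
  have vB k : `|v k| <= B by exact: dfB.
  have := tangent_growth_count n K1 B0 vB; cbv zeta.
  rewrite (_ : (\sum_(k < n.+1) _)%N = (\sum_(k < n.+1) s k x)%N)//.
  set c := (\sum_(k < n.+1) s k x)%N; set La := K * (B + 1).
  have La0 : 0 < La by apply: lt_le_trans La1.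
  move=> /le_trans /(_ (ler_wpM2r _ (le_trans (enorm_ge _) (opnorm_tangent v n)))).
  move=> /(_ _)/wrap[]; first by rewrite exprn_ge0// ltW.
  set o := opnorm _ => le_o.
  have K0 : 0 < K by lra.
  have o0 : 0 < o.
    have := lt_le_trans (exprn_gt0 n K0) le_o.
    by rewrite pmulr_lgt0// exprn_gt0.
  have : ln (K ^+ n) <= ln (o * La ^+ (2 * c)).
    by rewrite ler_ln// posrE ?exprn_gt0// mulr_gt0// exprn_gt0.
  rewrite lnM ?posrE ?exprn_gt0// !lnXn//.
  rewrite -[ln K *+ _]mulr_natl -[ln La *+ _]mulr_natl natrM => le_ln.
  have lnLa : 0 <= ln La by rewrite ln_ge0.
  have nR : 0 < n%:R :> R by rewrite ltr0n.
  rewrite mulrC ler_pdivlMr// /r.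
  have : 2 * c%:R * ln La <= 2 * (4 * p * n%:R) * ln La.
    by rewrite ler_wpM2r// ler_pM2l.
  lra.
have mlim : measurable (lim_sup_set W).
  by apply: bigcap_measurable => // k _; apply: bigcup_measurable.
have limsup0 : (phase_prob P (lim_sup_set W) <= 0%:E)%E.
  apply: phase_prob_fst_le => // z.
  have [N [mN PN hN]] := lamP z.
  apply: (@le_trans _ _ (P N)); last by rewrite PN.
  apply: le_measure; rewrite ?inE//.
    by have := measurable_xsection z mlim; rewrite xsectionE.
  move=> omega Womega; apply: hN => /= hcvg.
  have [n _ hn] : \forall n \near \oo, h n (z, omega) < r.
    exact: (cvgr_lt lam hcvg).
  have [m /= nm Wm] := Womega n.+1 I.
  have := hn m (ltnW nm); rewrite ltNge => /negP; apply.
  by apply: Wh => //; exact: leq_ltn_trans nm.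
have limsup0' : phase_prob P (lim_sup_set W) = 0%E.
  by apply/eqP; rewrite eq_le limsup0 measure_ge0.
have cvg0 : (phase_prob P (\bigcup_(k >= n) W k) @[n --> \oo] --> 0)%E.
  rewrite -limsup0'; apply: lim_sup_set_cvg => //.
  apply: le_lt_trans (probability_le1 _ _) (ltry _).
  by apply: bigcup_measurable => k _; exact: mW.
have half n : (((2^-1)%:E : \bar R) <= phase_prob P (\bigcup_(k >= n) W k))%E.
  pose m := (n + (Num.trunc ((i0%:R + p) / p)).+1)%N.
  apply: (@le_trans _ _ (phase_prob P (W m))).
    apply: (@count_markov _ _ _ (phase_prob P) s p i0 m p0 _ _ ms slowp); first by rewrite /m addnS.
    rewrite [leRHS]mulrC -ler_pdivrMr//; apply/ltW/(lt_le_trans (truncnS_gt _)).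
    by rewrite ler_nat leq_addl.
  apply: le_measure; rewrite ?inE.
  - exact: mW.
  - by apply: bigcup_measurable => k _; exact: mW.
  - by apply: (@bigcup_sup _ _ m); rewrite /m /= leq_addr.
have := lime_ge (cvgP _ cvg0) (@nearW _ \oo _ _ half).
rewrite (cvg_lim _ cvg0)// lee_fin => le0.
have : (0 : R) < 2^-1 by rewrite invr_gt0 ltr0n.
by rewrite ltNge le0.
Qed.

(** * Regularity of a periodic function of class C3 *)

Lemma powR_eventually_ge (R : realType) (g c : R) : 0 < g ->
  exists L0 : R, forall L, L0 <= L -> c <= L `^ g.
Proof.
move=> g0; exists (Num.max c 1 `^ g^-1) => L hL.
have m1 : 1 <= Num.max c 1 by rewrite le_max lexx orbT.
have m0 : 0 <= Num.max c 1 by exact: le_trans m1.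
apply: (@le_trans _ _ ((Num.max c 1 `^ g^-1) `^ g)).
  by rewrite -powRrM mulVf ?gt_eqF// powRr1// le_max lexx.
by apply: ge0_ler_powR; rewrite ?nnegrE ?powR_ge0 ?(ltW g0)//; apply: le_trans hL; exact: powR_ge0.
Qed.

Section c3_circle_function.
Variables (R : realType) (psi : R -> R).
Hypotheses (per : periodic psi 1) (C3 : is_C3 psi).

Lemma is_C3_derive k x : (k < 3)%N ->
  is_derive x (1 : R) (derive1n k psi) (derive1n k.+1 psi x).
Proof.
move=> k3; have [/(_ k x k3) dk _] := C3.
by rewrite derive1nS derive1E; exact/derivableP.
Qed.

Lemma is_C3_continuous k : (k <= 3)%N -> continuous (derive1n k psi).
Proof.
rewrite leq_eqVlt => /orP[/eqP->|k3]; first by case: C3.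
by apply: is_derive_continuous => x; exact: is_C3_derive.
Qed.

Lemma is_C3_periodic k : (k <= 3)%N -> periodic (derive1n k psi) 1.
Proof.
elim: k => [//|k IHk] k3; rewrite derive1nS.
apply: is_derive_periodic; last by apply: IHk; exact: ltnW.
by move=> x; have [/(_ k x k3)] := C3.
Qed.

(** The infimum only sees the zeros in [0, 1[; periodicity gives the others. *)
Lemma nondegenerate_zero k (x : R) : (k < 3)%N ->
  0 < inf [set `|derive1n k.+1 psi x| | x in
    [set x | 0 <= x < 1 /\ derive1n k psi x = 0]] ->
  derive1n k psi x = 0 -> derive1n k.+1 psi x != 0.
Proof.
move=> k3 inf0 dx0; rewrite -normr_gt0; apply: lt_le_trans inf0 _.
apply: ge_inf; first by exists 0 => _ [y _ <-].
exists (x + (- Num.floor x)%:~R); last first.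
  by rewrite (periodic_int _ _ (is_C3_periodic k3)).
split; last by rewrite (periodic_int _ _ (is_C3_periodic (ltnW k3))).
rewrite rmorphN/= subr_ge0 floor_le_tmp ltrBlDr addrC.
by rewrite -intrD1 floorD1_gt.
Qed.

Lemma circle_sublevel k : (k < 3)%N ->
  0 < inf [set `|derive1n k.+1 psi x| | x in
    [set x | 0 <= x < 1 /\ derive1n k psi x = 0]] ->
  exists2 A : R, 0 < A & forall t : R, 0 < t ->
    (circle_prob R [set x | (`|derive1n k psi x| <= t)%R] <= (A * t)%:E)%E.
Proof.
move=> k3 inf0.
have dk x : is_derive x (1 : R) (derive1n k psi) (derive1n k.+1 psi x).
  exact: is_C3_derive.
have ck : continuous (derive1n k.+1 psi) by exact: is_C3_continuous.
have nd x : derive1n k psi x = 0 -> derive1n k.+1 psi x != 0.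
  exact: nondegenerate_zero.
have [A A0 hA] := sublevel_measure dk ck nd.
exists A => // t t0; rewrite circle_probE; first exact: hA.
exact: (sublevel_measurable dk).
Qed.
End c3_circle_function.

(** * Choice of the scales *)

(** The ratio of the layers is q = L^(beta / 4), and J is chosen so that q^J is at
    least L^2; this makes the last layer negligible. *)
Lemma torus_slope_product (R : realType) (h : R -> R) (A B beta : R) :
  measurable_fun setT h -> 0 < A -> 0 < B -> 0 < beta ->
  (forall x, `|h x| <= B) ->
  (forall t : R, 0 < t -> (circle_prob R [set x | (`|h x| <= t)%R] <= (A * t)%:E)%E) ->
  exists2 c : R, 0 < c & forall L : R, 1 <= L ->
    (torus_prob R [set z | (`|(L * h z.1) * (L * h z.2)| <= L `^ (beta / 2))%R] <=
     (c * L `^ (beta * (3 / 4) - 2))%:E)%E.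
Proof.
move=> mh A0 B0 beta0 hB hA.
pose J := (Num.trunc (8 / beta)).+1.
have J8 : 8 / beta <= J%:R by rewrite ltW// truncnS_gt.
exists (J%:R * A ^+ 2 + A * B).
  by rewrite addr_gt0// mulr_gt0// ?ltr0n// exprn_gt0.
move=> L L1; have L0 : 0 < L by exact: lt_le_trans L1.
pose q := L `^ (beta / 4); pose tau := L `^ (beta / 2 - 2).
have q0 : 0 < q by exact: powR_gt0.
have tau0 : 0 < tau by exact: powR_gt0.
rewrite (_ : [set z | _] = [set z | `|h z.1 * h z.2| <= tau]); last first.
  have tauE : L `^ (beta / 2) = L ^+ 2 * tau.
    rewrite -powR_mulrn ?(ltW L0)// -powRD; last by rewrite (gt_eqF L0) implybT.
    by rewrite addrC subrK.
  have L20 : 0 < L ^+ 2 by rewrite exprn_gt0.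
  apply: eq_set => z; rewrite tauE mulrACA normrM -expr2.
  by rewrite (ger0_norm (ltW L20)) ler_pM2l.
apply: le_trans (torus_prob_small_product J mh B0 (ltW A0) q0 tau0 hB hA) _.
rewrite lee_fin mulrDl; apply: lerD.
  rewrite (_ : J%:R * (_ * q * tau) = J%:R * A ^+ 2 * (q * tau)); last by ring.
  rewrite ler_wpM2l ?mulr_ge0 ?exprn_ge0 ?(ltW A0)//.
  rewrite /q /tau -powRD; last by rewrite (gt_eqF L0) implybT.
  by rewrite (_ : beta / 4 + _ = beta * (3 / 4) - 2)//; field.
rewrite -mulrA ler_pM2l// ler_pM2l//.
rewrite /q -powR_mulrn ?powR_ge0// -powRrM -powRN ler_powR//.
rewrite lerNl opprB; have : 2 <= beta / 4 * J%:R.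
  by move: J8; rewrite ler_pdivrMr// => ?; lra.
have : 0 <= beta * (3 / 4) by rewrite mulr_ge0// ?ltW//.
lra.
Qed.

(** The derivative dg stays above half its value at x on the whole segment. *)
Lemma slope_separation (R : realType) (g dg ddg : R -> R) (B eta r x y : R) :
  (forall x, is_derive x (1 : R) g (dg x)) ->
  (forall x, is_derive x (1 : R) dg (ddg x)) ->
  (forall x, `|ddg x| <= B) ->
  eta <= `|dg x| -> `|x - y| <= r -> B * r <= eta / 2 -> 0 <= B ->
  eta / 2 * `|x - y| <= `|g x - g y|.
Proof.
move=> gdg dgddg ddgB etax xy Br B0.
apply: (increment_ge gdg) => t /andP[t1 t2].
have tx : `|x - t| <= `|x - y|.
  have /orP[xy'|xy'] := le_total x y;
    rewrite ?(min_l xy') ?(max_r xy') ?(min_r xy') ?(max_l xy') in t1 t2.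
    by rewrite !ler0_norm; lra.
  by rewrite !ger0_norm; lra.
have h1 := increment_le dgddg x t ddgB.
have h2 : B * `|x - t| <= eta / 2.
  by apply: le_trans Br; rewrite ler_wpM2l//; exact: le_trans xy.
have := lerB_dist (dg x) (dg x - dg t); rewrite opprB addrCA subrr addr0.
lra.
Qed.

(** The four sources of error receive p / 4 each, or p / 8 twice: the number M of
    kicks and their total variation cost, the products of slopes in the window,
    the last slope of the window, and the neighbourhood eta of the zeros of d2.
    The spacing s is kappa min(eps, 1) / L; the factor 1 / L compensates the slope
    of f in the cost of the kick, and the minimum keeps all the kicked points in
    the region where d2 has not changed by more than eta / 2. *)
Lemma slow_measure_small (R : realType) (psi d1 d2 d3 : R -> R)
    (B1 B3 A1 A2 alpha' beta p : R) :
  (forall x : R, is_derive x (1 : R) psi (d1 x)) ->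
  (forall x : R, is_derive x (1 : R) d1 (d2 x)) ->
  (forall x : R, is_derive x (1 : R) d2 (d3 x)) ->
  periodic psi 1 -> periodic d1 1 -> periodic d2 1 ->
  0 < B1 -> (forall x, `|d1 x| <= B1) -> 0 < B3 -> (forall x, `|d3 x| <= B3) ->
  0 < A1 -> (forall t : R, 0 < t ->
    (circle_prob R [set x | (`|d1 x| <= t)%R] <= (A1 * t)%:E)%E) ->
  0 < A2 -> (forall t : R, 0 < t ->
    (circle_prob R [set x | (`|d2 x| <= t)%R] <= (A2 * t)%:E)%E) ->
  0 < alpha' < 1 -> 0 < beta < 1 -> 0 < p ->
  exists L0 : R, forall L a eps : R, L0 <= L -> 1 < L ->
  forall eps0 : 0 < eps, L `^ (- (beta / 4) * L `^ (2 - beta)) <= eps ->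
  forall P : probability (noise R) R, is_noise_law eps0 P ->
  exists i0 : nat, forall k, (i0 <= k)%N ->
    (phase_prob P [set x | slow (L `^ alpha')%R (fun y => (L * d1 y)%R)
      (fLa psi L a) x.2 x.1 k] <= p%:E)%E.
Proof.
move=> dpsi dd1 dd2 per per1 per2 B10 d1B B30 d3B A10 hA1 A20 hA2.
move=> /andP[al0 al1] /andP[be0 be1] p0.
have mpsi : measurable_fun setT psi.
  by apply: continuous_measurable_fun; exact: is_derive_continuous.
have md1 : measurable_fun setT d1.
  by apply: continuous_measurable_fun; exact: is_derive_continuous.
have md2 : measurable_fun setT d2.
  by apply: continuous_measurable_fun; exact: is_derive_continuous.
have [c c0 hc] := torus_slope_product md1 A10 B10 be0 d1B hA1.
pose eta := p / (4 * A2).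
have eta0 : 0 < eta by rewrite divr_gt0// mulr_gt0.
have [M M_gt0 Mp] : exists2 M : nat, (0 < M)%N & M%:R^-1 <= p / 8.
  exists (Num.trunc (8 / p)).+1 => //.
  by rewrite -[leRHS]invf_div lef_pV2 ?posrE ?divr_gt0// ltW// truncnS_gt.
have M0 : 0 < M%:R :> R by rewrite ltr0n.
pose kappa := Num.min (p / (4 * (2 + B1) * M%:R)) (eta / (2 * B3 * M%:R)).
have kappa0 : 0 < kappa.
  by rewrite lt_min !divr_gt0// !mulr_gt0//; lra.
have kappa1 : (2 + B1) * M%:R * kappa <= p / 4.
  have : kappa <= p / (4 * (2 + B1) * M%:R) by rewrite ge_min lexx.
  by rewrite !ler_pdivlMr ?mulr_gt0//; [move=> ?; lra|lra].
have kappa2 : B3 * (kappa * M%:R) <= eta / 2.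
  have : kappa <= eta / (2 * B3 * M%:R) by rewrite ge_min lexx orbT.
  by rewrite !ler_pdivlMr ?mulr_gt0// => ?; lra.
have be40 : 0 < beta / 4 by lra.
have al10 : 0 < 1 - alpha' by lra.
pose bound := 4 + 8 / (eta * kappa) + 16 * c / p.
have [L1 hL1] := powR_eventually_ge bound be40.
have [L2 hL2] := powR_eventually_ge (16 * A1 / p) al10.
exists (Num.max L1 L2) => L a eps; rewrite ge_max => /andP[L1L L2L] L_gt1 eps0 eps_ge P lawP.
have {hL1 L1L} big := hL1 L L1L; have {hL2 L2L} big2 := hL2 L L2L.
have L0 : 0 < L by exact: lt_trans L_gt1.
have Lge1 : 1 <= L by exact: ltW.
have t1 : 0 < 8 / (eta * kappa) by rewrite divr_gt0// mulr_gt0.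
have t2 : 0 < 16 * c / p by rewrite divr_gt0// mulr_gt0.
have LNge1 : 1 <= L `^ (2 - beta).
  by rewrite -[leLHS](powRr0 L) ler_powR//; lra.
have [N [N_gt0 N_ge N_le]] : exists N : nat, [/\ (0 < N)%N,
    L `^ (2 - beta) <= N%:R & N%:R <= 2 * L `^ (2 - beta)].
  exists (Num.trunc (L `^ (2 - beta))).+1; split => //.
    by rewrite ltW// truncnS_gt.
  rewrite -natr1 mulrDl mul1r; apply: lerD => //.
  by rewrite truncn_le powR_ge0.
pose s := kappa * Num.min eps 1 / L.
have m0 : 0 < Num.min eps 1 by rewrite lt_min eps0 ltr01.
have s0 : 0 < s by rewrite divr_gt0// mulr_gt0.
have sL : s * L = kappa * Num.min eps 1 by rewrite /s divfK// gt_eqF.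
have s_kappa : s <= kappa.
  rewrite -(ler_pM2r L0) sL ler_pM2l//; apply: le_trans Lge1.
  by rewrite ge_min lexx orbT.
pose K := L `^ alpha'; have K1 : 1 <= K.
  by rewrite /K -(powRr0 L) ler_powR// ltW.
pose D := L * B1 * (s * M%:R).
exists (N.*2.+2) => k k_ge.
have -> : k = ((k - N.*2.+2).+1 + N.*2.+1)%N by rewrite addSnnS subnK.
have mf : measurable_fun setT (fLa psi L a).
  by apply: measurable_funD => //; exact: measurable_funM.
have mdf : measurable_fun setT (fun x => L * d1 x) by exact: measurable_funM.
have mrho : measurable [set x | eta <= `|d2 x|].
  apply: measurable_boolset; apply: measurable_fun_ler => //.
  exact: measurableT_comp.
have perf : periodic (fLa psi L a) 1 by move=> x; rewrite /fLa per.
have perdf : periodic (fun x => L * d1 x) 1 by move=> x; rewrite per1.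
have perrho x (k' : int) : [set x | eta <= `|d2 x|] (x + k'%:~R) ->
    [set x | eta <= `|d2 x|] x.
  by rewrite /= (periodic_int _ _ per2).
have K0 : 0 < K by exact: lt_le_trans K1.
have bL4 : (L `^ (beta / 4)) ^+ 2 = L `^ (beta / 2).
  rewrite -powR_mulrn ?powR_ge0// -powRrM; congr (_ `^ _); by field.
have theta_ge : 4 * L `^ (beta / 4) <= L `^ (beta / 2).
  by rewrite -bL4 expr2 ler_pM2r ?powR_gt0//; apply: le_trans big; rewrite /bound; lra.
have theta4 : 4 <= L `^ (beta / 2).
  apply: le_trans theta_ge; rewrite ler_peMr//; apply: le_trans big; rewrite /bound; lra.
have smM m : (m < M)%N -> 0 <= s *+ m <= s * M%:R.
  move=> mM; rewrite -mulr_natr mulr_ge0 ?(ltW s0)//= ler_pM2l// ler_nat ltnW//.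
have fD x m : (m < M)%N -> `|fLa psi L a x - fLa psi L a (x + s *+ m)| <= D.
  move=> /smM /andP[sm0 smM'].
  rewrite /fLa opprD addrACA subrr addr0 -mulrBr normrM (gtr0_norm L0) /D -mulrA.
  rewrite ler_pM2l//; apply: le_trans (increment_le dpsi _ _ d1B) _.
  by rewrite ler_pM2l// opprD addNKr normrN ger0_norm.
have sep x m m' : (m < M)%N -> (m' < M)%N -> m != m' ->
    [set x | eta <= `|d2 x|] (x + s *+ m) ->
    2 < `|L * d1 (x + s *+ m) - L * d1 (x + s *+ m')| *
      (K * ((L `^ (beta / 2) / 4) ^+ N) ^+ 2).
  move=> mM mM' mm' rhom.
  set x1 := x + s *+ m; set x2 := x + s *+ m'.
  have x12 : x1 - x2 = s * (m%:R - m'%:R).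
    by rewrite /x1 /x2 -(mulr_natr s m) -(mulr_natr s m'); ring.
  have dist_le : `|x1 - x2| <= s * M%:R.
    rewrite x12 normrM (gtr0_norm s0) ler_pM2l// ler_norml.
    have : m%:R <= M%:R :> R by rewrite ler_nat ltnW.
    have : m'%:R <= M%:R :> R by rewrite ler_nat ltnW.
    by have := ler0n R m; have := ler0n R m'; lra.
  have dist_ge : s <= `|x1 - x2|.
    rewrite x12 normrM (gtr0_norm s0) ler_peMr// ?(ltW s0)//.
    have /orP[lt_m|lt_m] : (m < m')%N || (m' < m)%N by rewrite -neq_ltn.
      rewrite distrC ger0_norm ?subr_ge0 ?ler_nat 1?ltnW//.
      by rewrite lerBrDl -[1]/(1%:R) -natrD ler_nat addn1.
    rewrite ger0_norm ?subr_ge0 ?ler_nat 1?ltnW//.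
    by rewrite lerBrDl -[1]/(1%:R) -natrD ler_nat addn1.
  have B3r : B3 * (s * M%:R) <= eta / 2.
    by apply: le_trans kappa2; rewrite ler_pM2l// ler_pM2r.
  have h1 := slope_separation dd1 dd2 d3B rhom dist_le B3r (ltW B30).
  have h2 : eta / 2 * (kappa * Num.min eps 1) <= `|L * d1 x1 - L * d1 x2|.
    rewrite -mulrBr normrM (gtr0_norm L0) -sL.
    rewrite (_ : eta / 2 * (s * L) = L * (eta / 2 * s)); last by ring.
    rewrite ler_pM2l//.
    by apply: le_trans h1; rewrite ler_pM2l// divr_gt0.
  (* T bounds the squared growth of the window from below, and E the noise
     amplitude; the exponent beta / 4 in E leaves room for L^(beta / 4). *)
  pose T := L `^ (beta / 2 * L `^ (2 - beta)).
  have h3 : T <= K * ((L `^ (beta / 2) / 4) ^+ N) ^+ 2.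
    apply: (@le_trans _ _ (((L `^ (beta / 4)) ^+ N) ^+ 2)); last first.
      apply: (@le_trans _ _ (((L `^ (beta / 2) / 4) ^+ N) ^+ 2)); last first.
        by rewrite ler_peMl// exprn_ge0// exprn_ge0// divr_ge0// powR_ge0.
      rewrite ler_sqr ?nnegrE ?exprn_ge0 ?divr_ge0 ?powR_ge0//.
      rewrite lerXn2r ?nnegrE ?divr_ge0 ?powR_ge0// ler_pdivlMr// mulrC.
      exact: theta_ge.
    rewrite -exprM mulnC exprM bL4 -powR_mulrn ?powR_ge0// -powRrM /T ler_powR//.
    by rewrite ler_pM2l// divr_gt0.
  pose E := L `^ (- (beta / 4) * L `^ (2 - beta)).
  have h4 : E <= Num.min eps 1.
    rewrite le_min eps_ge /= -(powRr0 L) ler_powR//.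
    by rewrite mulNr oppr_le0 mulr_ge0 ?powR_ge0// ltW.
  have h5 : L `^ (beta / 4) <= E * T.
    rewrite /E /T -powRD; last by rewrite (gt_eqF L0) implybT.
    rewrite ler_powR// -mulrDl (_ : - (beta / 4) + beta / 2 = beta / 4); last by field.
    by rewrite ler_peMr// ltW.
  have T0 : 0 < T by exact: powR_gt0.
  have ek : 0 < eta * kappa by exact: mulr_gt0.
  have h6 : 4 <= eta / 2 * (kappa * Num.min eps 1) * T.
    apply: (@le_trans _ _ (eta / 2 * (kappa * E) * T)); last first.
      apply: ler_wpM2r (ltW T0) _ _ _.
      apply: ler_wpM2l; first by rewrite divr_ge0// ltW.
      by apply: ler_wpM2l h4; exact: ltW.
    rewrite (_ : eta / 2 * (kappa * E) * T = eta * kappa / 2 * (E * T)); last by field.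
    apply: (@le_trans _ _ (eta * kappa / 2 * (8 / (eta * kappa)))).
      by rewrite le_eqVlt; apply/orP; left; apply/eqP; field; rewrite !gt_eqF.
    rewrite ler_pM2l ?divr_gt0//; apply: le_trans h5; apply: le_trans big.
    by rewrite /bound; lra.
  apply: (@lt_le_trans _ _ 4); first by lra.
  apply: (le_trans h6); apply: ler_pM h2 h3; last exact: ltW.
  by apply: mulr_ge0; [rewrite divr_ge0// ltW|rewrite mulr_ge0// ltW].
have hp1 := hc L Lge1.
have hp2 : (circle_prob R [set x | (`|L * d1 x| <= 4 * K)%R] <= (p / 4)%:E)%E.
  have tK0 : 0 < 4 * K / L by rewrite divr_gt0// mulr_gt0.
  rewrite (_ : [set x | _] = [set x | `|d1 x| <= 4 * K / L]); last first.
    by apply: eq_set => x; rewrite normrM (gtr0_norm L0) mulrC ler_pdivlMr.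
  apply: le_trans (hA1 _ tK0) _; rewrite lee_fin mulrA ler_pdivrMr//.
  have KL : K * L `^ (1 - alpha') = L.
    rewrite /K -powRD; last by rewrite (gt_eqF L0) implybT.
    by rewrite addrC subrK powRr1 ?(ltW L0).
  rewrite -[X in _ <= _ * X]KL.
  have : 16 * A1 * K <= p * L `^ (1 - alpha') * K.
    by rewrite ler_pM2r// [leRHS]mulrC -ler_pdivrMr.
  by move=> ?; lra.
have hp3 : (circle_prob R (~` [set x | (eta <= `|d2 x|)%R]) <= (p / 4)%:E)%E.
  rewrite (_ : p / 4 = A2 * eta); last first.
    by rewrite /eta; field; rewrite gt_eqF.
  apply: le_trans (hA2 _ eta0); apply: le_measure; rewrite ?inE.
  - exact: measurableC.
  - apply: measurable_boolset; apply: measurable_fun_ler => //.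
    exact: measurableT_comp.
  - by move=> x /negP; rewrite -ltNge => /ltW.
apply: le_trans (slow_measure _ lawP mf mdf mrho perf perdf perrho K0 theta4
  N_gt0 M_gt0 s0 fD sep hp1 hp2 hp3) _.
rewrite lee_fin.
have noise_part : (2 * s *+ M + D) / (2 * eps) <= p / 8.
  have s_eps : s * L <= kappa * eps.
    by rewrite sL ler_pM2l// ge_min lexx.
  have s_eps' : s <= kappa * eps.
    by apply: le_trans s_eps; rewrite ler_peMr// ltW.
  have h1 : 2 * s *+ M <= 2 * (M%:R * (kappa * eps)).
    by rewrite -(mulr_natr (2 * s)) -mulrA ler_pM2l// mulrC ler_pM2l.
  have h2 : D <= B1 * (M%:R * (kappa * eps)).
    rewrite (_ : D = B1 * (M%:R * (s * L))); last by rewrite /D; ring.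
    by rewrite !ler_pM2l.
  rewrite ler_pdivrMr ?mulr_gt0//.
  have : (2 + B1) * M%:R * kappa * eps <= p / 4 * eps by rewrite ler_pM2r.
  lra.
have orbit_part : (c * L `^ (beta * (3 / 4) - 2)) *+ N.*2 <= p / 4.
  rewrite -(mulr_natr _ N.*2) -muln2 natrM mulrA.
  apply: (@le_trans _ _ (c * L `^ (beta * (3 / 4) - 2) * (2 * L `^ (2 - beta)) * 2)).
    by rewrite ler_pM2r// ler_pM2l// mulr_gt0// powR_gt0.
  rewrite (_ : c * _ * _ * 2 =
    4 * c * (L `^ (beta * (3 / 4) - 2) * L `^ (2 - beta))); last by ring.
  rewrite -powRD; last by rewrite (gt_eqF L0) implybT.
  rewrite (_ : beta * (3 / 4) - 2 + (2 - beta) = - (beta / 4)); last by field.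
  rewrite powRN ler_pdivrMr ?powR_gt0//.
  have : 16 * c / p <= L `^ (beta / 4) by apply: le_trans big; rewrite /bound; lra.
  by rewrite ler_pdivrMr// => ?; lra.
by apply: le_trans (lerD (lerD Mp noise_part) (lerD (lerD orbit_part (lexx _)) (lexx _))) _; lra.
Qed.

(** With p = (1 - alpha) / 48 and log(K (L B1 + 1)) <= 3 log L, the bound of
    [lambda1_ge] is exactly alpha log L. *)
Lemma lambda1_ge_large (R : realType) (psi d1 d2 d3 : R -> R)
    (B1 B3 A1 A2 alpha beta : R) :
  (forall x : R, is_derive x (1 : R) psi (d1 x)) ->
  (forall x : R, is_derive x (1 : R) d1 (d2 x)) ->
  (forall x : R, is_derive x (1 : R) d2 (d3 x)) ->
  periodic psi 1 -> periodic d1 1 -> periodic d2 1 ->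
  0 < B1 -> (forall x, `|d1 x| <= B1) -> 0 < B3 -> (forall x, `|d3 x| <= B3) ->
  0 < A1 -> (forall t : R, 0 < t ->
    (circle_prob R [set x | (`|d1 x| <= t)%R] <= (A1 * t)%:E)%E) ->
  0 < A2 -> (forall t : R, 0 < t ->
    (circle_prob R [set x | (`|d2 x| <= t)%R] <= (A2 * t)%:E)%E) ->
  0 < alpha < 1 -> 0 < beta < 1 ->
  exists L0 : R, forall L a eps : R, L0 <= L -> 1 < L ->
  forall eps0 : 0 < eps, L `^ (- (beta / 4) * L `^ (2 - beta)) <= eps ->
  forall (P : probability (noise R) R) (lam : R),
    is_noise_law eps0 P -> is_lambda1 P (fLa psi L a) lam ->
    alpha * ln L <= lam.
Proof.
move=> dpsi dd1 dd2 per per1 per2 B10 d1B B30 d3B A10 hA1 A20 hA2 halpha hbeta.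
have /andP[al0 al1] := halpha.
pose p := (1 - alpha) / 48; have p0 : 0 < p by rewrite divr_gt0// subr_gt0.
have al'01 : 0 < (1 + alpha) / 2 < 1 by apply/andP; split; lra.
have [L1 hL1] := slow_measure_small dpsi dd1 dd2 per per1 per2 B10 d1B B30 d3B
  A10 hA1 A20 hA2 al'01 hbeta p0.
exists (Num.max L1 (B1 + 1)) => L a eps; rewrite ge_max.
move=> /andP[L1L BL] L_gt1 eps0 eps_ge P lam lawP lamP.
have [i0 slowp] := hL1 L a eps L1L L_gt1 eps0 eps_ge P lawP.
have L0 : 0 < L by exact: lt_trans L_gt1.
have df x : is_derive x (1 : R) (fLa psi L a) (L * d1 x).
  have dx := dpsi x; rewrite (_ : fLa psi L a = (L *: psi) + cst a)//.
  by apply: is_derive_eq; rewrite addr0.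
have mdf : measurable_fun setT (fun x => L * d1 x).
  by apply: measurable_funM => //; apply: continuous_measurable_fun; exact: is_derive_continuous.
have dfB x : `|L * d1 x| <= L * B1.
  by rewrite normrM gtr0_norm// ler_pM2l.
set K := L `^ ((1 + alpha) / 2) in slowp.
have K1 : 1 <= K by rewrite /K -[leLHS](powRr0 L) ler_powR ?ltW//; lra.
have LB0 : 0 <= L * B1 by rewrite mulr_ge0// ltW.
apply: le_trans (lambda1_ge df mdf dfB K1 LB0 p0 slowp lamP).
have lnL0 : 0 <= ln L by rewrite ln_ge0// ltW.
have lnK : ln K = (1 + alpha) / 2 * ln L by rewrite /K ln_powR.
have lnKB : ln (K * (L * B1 + 1)) <= 3 * ln L.
  have KL : K <= L.
    by rewrite /K -[leRHS](powRr1 (ltW L0)) ler_powR ?ltW//; lra.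
  have LB : L * B1 + 1 <= L ^+ 2 by rewrite expr2; nra.
  have K0 : 0 < K by exact: lt_le_trans K1.
  have LB10 : 0 < L * B1 + 1 by lra.
  apply: (@le_trans _ _ (ln (L ^+ 3))); last by rewrite lnXn// mulr_natl.
  rewrite ler_ln ?posrE ?exprn_gt0 ?mulr_gt0//.
  by rewrite exprS; apply: ler_pM => //; exact: ltW.
have : 8 * p * ln (K * (L * B1 + 1)) <= 8 * p * (3 * ln L).
  by rewrite ler_wpM2l// mulr_ge0// ltW.
by rewrite lnK /p; lra.
Qed.

Unset Implicit Arguments.
Set Strict Implicit.

Theorem theorem2 (R : realType) (alpha beta : R)
    (halpha : 0 < alpha < 1) (hbeta : 0 < beta < 1) :
  exists2 C : R, 0 < C &
  forall (psi : R -> R) (c0 : R),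
    periodic psi 1 -> is_C3 psi -> nondegenerate_crit psi -> 0 < c0 ->
  exists L0 : R, forall L a eps : R, L0 <= L -> 1 < L -> 0 <= a < 1 ->
    (forall x x' : R, crit1 psi x -> crit1 psi x' ->
       ~ circle_nbhd c0 (crit1 psi) (mod1 (fLa psi L a x - x'))) ->
  forall eps0 : 0 < eps, L `^ (- C * L `^ (2 - beta)) <= eps ->
  forall (P : probability (noise R) R) (lam : R),
    is_noise_law eps0 P -> is_lambda1 P (fLa psi L a) lam ->
    alpha * ln L <= lam.
Proof.
exists (beta / 4); first by case/andP: hbeta => ? _; rewrite divr_gt0.
move=> psi c0 per C3 [_ _ inf1 inf2] _.
have dpsi x := is_C3_derive C3 x (isT : (0 < 3)%N).
have dd1 x := is_C3_derive C3 x (isT : (1 < 3)%N).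
have dd2 x := is_C3_derive C3 x (isT : (2 < 3)%N).
have per1 := is_C3_periodic per C3 (isT : (1 <= 3)%N).
have per2 := is_C3_periodic per C3 (isT : (2 <= 3)%N).
have per3 := is_C3_periodic per C3 (isT : (3 <= 3)%N).
have [A1 A10 hA1] := circle_sublevel per C3 (isT : (1 < 3)%N) inf1.
have [A2 A20 hA2] := circle_sublevel per C3 (isT : (2 < 3)%N) inf2.
have [B1 B10 d1B] := periodic_bounded (is_C3_continuous C3 (isT : (1 <= 3)%N)) per1.
have [B3 B30 d3B] := periodic_bounded (is_C3_continuous C3 (isT : (3 <= 3)%N)) per3.
have [L0 hL0] := lambda1_ge_large dpsi dd1 dd2 per per1 per2 B10 d1B B30 d3B
  A10 hA1 A20 hA2 halpha hbeta.
exists L0 => L a eps L0L L_gt1 _ _; exact: hL0.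
Qed.
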